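(* Let $k$ be a field, $n \ge 3$, let $G$ be a simple graph on the vertex set $\{1,\dots,n\}$, and let $m \ge 3$ be an integer. Then $I_G^{(m)}$ is a Cohen-Macaulay ideal if and only if every pair of disjoint edges of $G$ is contained in a cycle of length 4 of $G$.
   Context: Let $S = k[x_1,\dots,x_n]$ be a polynomial ring. A simple graph here means a finite undirected graph without multiple edges, without loops and without isolated vertices (every vertex in $\{1,\dots,n\}$ belongs to an edge). We write $\{i,j\}\in G$ if $\{i,j\}$ is an edge of $G$. For $i \ne j$ put $P_{ij} = (x_t \mid t \ne i,j)$, the prime ideal of $S$ generated by all variables other than $x_i,x_j$. Define $I_G = \bigcap_{\{i,j\}\in G} P_{ij}$ and its $m$-th symbolic power $I_G^{(m)} = \bigcap_{\{i,j\}\in G} P_{ij}^m$. An ideal $I$ of $S$ is called Cohen-Macaulay if $S/I$ is a Cohen-Macaulay ring. Two edges are disjoint if they have no common vertex. A cycle of length 4 of $G$ is a (not necessarily induced) subgraph consisting of four distinct vertices $a,b,c,d$ and the edges $\{a,b\},\{b,c\},\{c,d\},\{d,a\}$ of $G$. *)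

(* Defs.v *)
From HB Require Import structures.
From mathcomp Require Import all_boot all_algebra ring_quotient ring.
From mathcomp Require Import boolp mpoly.

Set Implicit Arguments.
Unset Strict Implicit.
Unset Printing Implicit Defensive.

Import GRing.Theory.

Local Open Scope ring_scope.
Local Open Scope quotient_scope.

(* The structures [idealr] and [prime_idealr] of MathComp consist of boolean  *)
(* predicates and contain proper ideals only.  Every proposition is decidable *)
(* with [boolp], so quantifying over them is quantifying over all proper      *)
(* (resp. prime) ideals of a commutative ring.  Ideals given by a formula are *)
(* predicates R -> Prop, and may be improper.                                 *)

Section Ideals.
Variable R : comNzRingType.
Implicit Types I J X : R -> Prop.

Definition ideal_gen X : R -> Prop := fun f =>
  exists2 s : seq (R * R), (forall p, p \in s -> X p.2)
                         & f = \sum_(p <- s) p.1 * p.2.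

Definition ideal_mul I J : R -> Prop :=
  ideal_gen (fun h => exists f g, [/\ I f, J g & h = f * g]).

Definition ideal_pow I (m : nat) : R -> Prop :=
  iter m (ideal_mul I) (fun=> True).

Definition ideal_of_seq (s : seq R) : R -> Prop := ideal_gen (fun x => x \in s).

Definition maximal_ideal (M : idealr R) : Prop :=
  forall J : idealr R, {subset M <= J} -> {subset J <= M}.

Definition noetherian : Prop :=
  forall J : idealr R, exists s : seq R, forall x, x \in J <-> ideal_of_seq s x.

End Ideals.

(* The localization of R at a prime ideal P: pairs (a, s) with s outside P,   *)
(* where (a, s) ~ (b, t) when u * (a * t) = u * (b * s) for some u outside P. *)
Section Localization.
Variables (R : comNzRingType) (P : prime_idealr R).

Definition fraction : Type := (R * {s : R | s \notin P})%type.

Implicit Types (s t : {s : R | s \notin P}) (x y : fraction).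

Definition fraction_eq x y : bool :=
  `[< exists2 u, u \notin P & u * (x.1 * sval y.2) = u * (y.1 * sval x.2) >].

Lemma notin_prime1 : 1 \notin P.
Proof. by rewrite idealr1. Qed.

Lemma notin_primeM (a b : R) : a \notin P -> b \notin P -> a * b \notin P.
Proof. by move=> aP bP; rewrite prime_idealrM negb_or aP. Qed.

Definition den1 : {s : R | s \notin P} := exist _ 1 notin_prime1.

Definition denM s t : {s : R | s \notin P} :=
  exist _ (sval s * sval t) (notin_primeM (valP s) (valP t)).

Lemma fraction_eqP x y :
  reflect (exists2 u, u \notin P & u * (x.1 * sval y.2) = u * (y.1 * sval x.2))
          (fraction_eq x y).
Proof. exact: asboolP. Qed.

Lemma fraction_eq_class : equiv_class_of fraction_eq.
Proof.
split=> [x|x y|y x z].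
- by apply/fraction_eqP; exists 1; first exact: notin_prime1.
- by apply/idP/idP => /fraction_eqP[u uP e]; apply/fraction_eqP; exists u.
- move=> /fraction_eqP[u uP e1] /fraction_eqP[v vP e2]; apply/fraction_eqP.
  exists (u * v * sval y.2).
    exact: notin_primeM (notin_primeM uP vP) (valP y.2).
  transitivity (v * sval z.2 * (u * (x.1 * sval y.2))); first by ring.
  rewrite e1; transitivity (u * sval x.2 * (v * (y.1 * sval z.2))); first by ring.
  by rewrite e2; ring.
Qed.

Canonical fraction_equiv := EquivRelPack fraction_eq_class.
Canonical fraction_encModRel := defaultEncModRel fraction_eq.

Definition localization := {eq_quot fraction_eq}.

HB.instance Definition _ : EqQuotient fraction fraction_eq localization :=
  EqQuotient.on localization.
HB.instance Definition _ := Choice.on localization.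

Definition loc x : localization := \pi_localization x.

Lemma locP x y :
  loc x = loc y <->
  exists2 u, u \notin P & u * (x.1 * sval y.2) = u * (y.1 * sval x.2).
Proof. by split=> [/eqmodP/fraction_eqP|/fraction_eqP/eqmodP]. Qed.

Lemma locK (q : localization) : loc (repr q) = q.
Proof. exact: reprK. Qed.

Definition fraction_add x y : fraction :=
  (x.1 * sval y.2 + y.1 * sval x.2, denM x.2 y.2).
Definition fraction_mul x y : fraction := (x.1 * y.1, denM x.2 y.2).
Definition fraction_opp x : fraction := (- x.1, x.2).

Definition loc_zero : localization := loc (0, den1).
Definition loc_one : localization := loc (1, den1).
Definition loc_add (p q : localization) := loc (fraction_add (repr p) (repr q)).
Definition loc_mul (p q : localization) := loc (fraction_mul (repr p) (repr q)).
Definition loc_opp (p : localization) := loc (fraction_opp (repr p)).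

Lemma loc_addE x y : loc_add (loc x) (loc y) = loc (fraction_add x y).
Proof.
have /locP[u uP /= e1] := locK (loc x); have /locP[v vP /= e2] := locK (loc y).
apply/locP; exists (u * v) => /=; first exact: notin_primeM.
set x' := repr _ in e1 *; set y' := repr _ in e2 *.
transitivity (v * sval y'.2 * sval y.2 * (u * (x'.1 * sval x.2)) +
              u * sval x'.2 * sval x.2 * (v * (y'.1 * sval y.2))); first by ring.
by rewrite e1 e2; ring.
Qed.

Lemma loc_mulE x y : loc_mul (loc x) (loc y) = loc (fraction_mul x y).
Proof.
have /locP[u uP /= e1] := locK (loc x); have /locP[v vP /= e2] := locK (loc y).
apply/locP; exists (u * v) => /=; first exact: notin_primeM.
set x' := repr _ in e1 *; set y' := repr _ in e2 *.
transitivity ((u * (x'.1 * sval x.2)) * (v * (y'.1 * sval y.2))); first by ring.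
by rewrite e1 e2; ring.
Qed.

Lemma loc_oppE x : loc_opp (loc x) = loc (fraction_opp x).
Proof.
have /locP[u uP /= e] := locK (loc x); apply/locP; exists u => //=.
by rewrite !mulNr !mulrN e.
Qed.

Lemma eq_loc x y : x.1 * sval y.2 = y.1 * sval x.2 -> loc x = loc y.
Proof. by move=> e; apply/locP; exists 1; [exact: notin_prime1 | rewrite e]. Qed.

Lemma loc_addA : associative loc_add.
Proof.
move=> p q r; rewrite -(locK p) -(locK q) -(locK r) !loc_addE.
by apply: eq_loc => /=; ring.
Qed.

Lemma loc_addC : commutative loc_add.
Proof.
by move=> p q; rewrite -(locK p) -(locK q) !loc_addE; apply: eq_loc => /=; ring.
Qed.

Lemma loc_add0 : left_id loc_zero loc_add.
Proof. by move=> p; rewrite -(locK p) loc_addE; apply: eq_loc => /=; ring. Qed.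

Lemma loc_addN : left_inverse loc_zero loc_opp loc_add.
Proof.
by move=> p; rewrite -(locK p) loc_oppE loc_addE; apply: eq_loc => /=; ring.
Qed.

Lemma loc_mulA : associative loc_mul.
Proof.
move=> p q r; rewrite -(locK p) -(locK q) -(locK r) !loc_mulE.
by apply: eq_loc => /=; ring.
Qed.

Lemma loc_mulC : commutative loc_mul.
Proof.
by move=> p q; rewrite -(locK p) -(locK q) !loc_mulE; apply: eq_loc => /=; ring.
Qed.

Lemma loc_mul1 : left_id loc_one loc_mul.
Proof. by move=> p; rewrite -(locK p) loc_mulE; apply: eq_loc => /=; ring. Qed.

Lemma loc_mulDl : left_distributive loc_mul loc_add.
Proof.
move=> p q r; rewrite -(locK p) -(locK q) -(locK r) !(loc_mulE, loc_addE).
by apply: eq_loc => /=; ring.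
Qed.

Lemma loc_oner_neq0 : loc_one != loc_zero.
Proof.
apply/eqP => /locP[u uP /=]; rewrite !mulr1 mulr0 => u0.
by move: uP; rewrite u0 idealr0.
Qed.

HB.instance Definition _ :=
  GRing.isZmodule.Build localization loc_addA loc_addC loc_add0 loc_addN.
HB.instance Definition _ :=
  GRing.Zmodule_isComNzRing.Build localization
    loc_mulA loc_mulC loc_mul1 loc_mulDl loc_oner_neq0.

End Localization.

Section CohenMacaulay.

Definition prime_chain (A : comNzRingType) (d : nat) : Prop :=
  exists Q : 'I_d.+1 -> prime_idealr A, forall i j : 'I_d.+1, (i < j)%N ->
    {subset Q i <= Q j} /\ exists2 x, x \in Q j & x \notin Q i.

Definition krull_dim_is (A : comNzRingType) (d : nat) : Prop :=
  prime_chain A d /\ forall e, prime_chain A e -> (e <= d)%N.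

Definition regular_sequence (A : comNzRingType) (s : seq A) : Prop :=
  ~ ideal_of_seq s 1 /\
  forall i y, (i < size s)%N ->
    ideal_of_seq (take i s) (s`_i * y) -> ideal_of_seq (take i s) y.

Definition regular_in (A : comNzRingType) (M : idealr A) (d : nat) : Prop :=
  exists s : seq A, [/\ size s = d, {subset s <= M} & regular_sequence s].

Definition depth_is (A : comNzRingType) (M : idealr A) (d : nat) : Prop :=
  regular_in M d /\ forall e, regular_in M e -> (e <= d)%N.

Definition local_ring (A : comNzRingType) (M : idealr A) : Prop :=
  maximal_ideal M /\ forall N : idealr A, maximal_ideal N -> N =i M.

Definition cohen_macaulay_local (A : comNzRingType) : Prop :=
  exists2 M : idealr A, local_ring M
                      & exists d, krull_dim_is A d /\ depth_is M d.

Definition cohen_macaulay_ring (A : comNzRingType) : Prop :=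
  noetherian A /\
  forall P : prime_idealr A, maximal_ideal P ->
    cohen_macaulay_local (localization P).

(* [{ideal_quot J}] needs the structure [idealr] on the ideal: J is I itself, *)
(* so I has to be proper for its quotient to be a Cohen-Macaulay ring.        *)
Definition cohen_macaulay_ideal (R : comNzRingType) (I : R -> Prop) : Prop :=
  exists2 J : idealr R, (forall f, f \in J <-> I f)
                      & cohen_macaulay_ring {ideal_quot J}.

End CohenMacaulay.

Section Graphs.
Variable n : nat.

(* A graph on the vertices 'I_n is given by its set of edges.                 *)
Definition simple_graph (G : {set {set 'I_n}}) : Prop :=
  (forall E, E \in G -> #|E| = 2) /\ cover G = [set: 'I_n].

Definition cycle4_edges (a b c d : 'I_n) : {set {set 'I_n}} :=
  [set [set a; b]; [set b; c]; [set c; d]; [set d; a]].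

Definition is_cycle4 (G : {set {set 'I_n}}) (a b c d : 'I_n) : Prop :=
  uniq [:: a; b; c; d] /\ cycle4_edges a b c d \subset G.

Variable k : fieldType.

Definition edge_prime (i j : 'I_n) : {mpoly k[n]} -> Prop :=
  ideal_gen (fun f => exists t : 'I_n, [/\ t != i, t != j & f = 'X_t]).

Definition symbolic_power (G : {set {set 'I_n}}) (m : nat) :
    {mpoly k[n]} -> Prop := fun f =>
  forall i j : 'I_n, [set i; j] \in G -> ideal_pow (edge_prime i j) m f.

End Graphs.

Arguments edge_prime {n} k i j f.
Arguments symbolic_power {n} k G m f.

(* Main.v *)
(* Write u for the sum of the variables, v for the sum of the x_i^(i+1), and   *)
(* P_e for the prime ideal of an edge e.  A monomial x^a lies outside P_e^m    *)
(* when its degree in the variables outside e is less than m; call e light for *)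
(* a in that case.                                                             *)
(*                                                                             *)
(* If disjoint edges lie on 4-cycles, then two disjoint edges that are light   *)
(* for a are both met by a third light edge, because the two other edges of    *)
(* the cycle have the same total weight.  Hence elements c_e of S that agree   *)
(* modulo P_e^m + P_e'^m for all pairs of meeting edges come from one element  *)
(* c of S modulo all the P_e^m.  A maximal ideal contains p(u) and q(v) for    *)
(* some monic p and q by the Nullstellensatz (only residue fields generated by *)
(* two elements occur).  They form a regular sequence modulo every P_e^m, and  *)
(* p(u) is regular modulo P_e^m + P_e'^m: substituting x_t + Y for x_t, or     *)
(* x_i - Y, x_j + Y for x_i, x_j, makes them monic in Y up to sign, and monic  *)
(* polynomials are regular modulo every ideal.  By gluing they form a regular  *)
(* sequence modulo the symbolic power.  The dimension is at most 2 since any   *)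
(* three elements of k[x_i,x_j] are algebraically dependent, and a regular     *)
(* sequence of length 2 yields a chain of primes of length 2.                  *)
(*                                                                             *)
(* Conversely, if disjoint edges pq and rs lie on no 4-cycle, then up to       *)
(* symmetry neither pr nor ps is an edge.  For a = (m-1)p + r + s the element  *)
(* that is x^a near r and s and 0 near the other variables is a section over   *)
(* the punctured spectrum, because x_i^m x_j^m x^a lies in the symbolic power  *)
(* for i outside {r,s} and j in it.  Depth 2 would extend it to an element     *)
(* whose coefficient at a is 0 modulo P_pq^m and a unit modulo P_rs^m.         *)

(* The quotient by the symbolic power has dimension two at every maximal ideal, so
   Cohen-Macaulayness asks for depth two there, that is, for sections over the punctured spectrum to
   extend. Since the ideals are monomial, this is decided one exponent vector at a time: the
   obstruction at [a] is that the edges with [weight e a < m] form a disconnected graph. The 4-cycle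
   condition keeps all these graphs connected ([cycle4_light_edge], [cycle4_connect]).

   Sufficiency is [symbolic_power_cohen_macaulay]. Regularity modulo a single edge power is
   elementary ([shift_regular], [slide_regular]); connectedness enters through [glue], which turns
   quotients found edge by edge into a global one in [vsum_regular]. [residue_integral] supplies
   such elements inside any maximal ideal; [prime_chain_le2] and [regular_sequence_chain] then
   squeeze dimension and depth to 2.

   Necessity is [not_cohen_macaulay], at the origin: if two disjoint edges lie on no 4-cycle, there
   is an exponent [alpha] for which both are light but lie in different components. The resulting
   section ([separating_monomial]) would extend by [regular_pair_extend], which is absurd. *)
From HB Require Import structures.
Require Import Defs.
From mathcomp Require Import all_boot all_algebra mpoly.
From mathcomp Require Import ring_quotient ring zify boolp.
From mathcomp Require classical_sets.

(** * Ideals and regular sequences *)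

Section IdealPredicates.
Import classical_sets.
Set Implicit Arguments.
Unset Strict Implicit.
Import GRing.Theory.
Local Open Scope ring_scope.

Variable R : comNzRingType.
Implicit Types I X T : R -> Prop.

Definition is_ideal I : Prop :=
  [/\ I 0, forall x y, I x -> I y -> I (x + y) & forall a x, I x -> I (a * x)].

Lemma is_idealN I x : is_ideal I -> I x -> I (- x).
Proof. by case=> _ _ iM Ix; rewrite -mulN1r; apply: iM. Qed.

Lemma is_idealB I x y : is_ideal I -> I x -> I y -> I (x - y).
Proof. by move=> iI Ix Iy; have [_ iD _] := iI; apply: iD => //; apply: is_idealN. Qed.

Lemma is_idealMr I x a : is_ideal I -> I x -> I (x * a).
Proof. by case=> _ _ iM Ix; rewrite mulrC; apply: iM. Qed.

Lemma is_ideal_sum I (K : eqType) (r : seq K) (P : pred K) (F : K -> R) :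
  is_ideal I -> (forall i, i \in r -> P i -> I (F i)) -> I (\sum_(i <- r | P i) F i).
Proof.
case=> i0 iD _ IF; rewrite big_seq_cond; apply: (big_ind I) => // i /andP[ir Pi].
exact: IF.
Qed.

Lemma is_ideal_gen X : is_ideal (ideal_gen X).
Proof.
split.
- by exists [::] => //; rewrite big_nil.
- move=> x y [s Xs ->] [t Xt ->]; exists (s ++ t); last by rewrite big_cat.
  by move=> p; rewrite mem_cat => /orP[/Xs|/Xt].
- move=> a x [s Xs ->]; exists [seq (a * p.1, p.2) | p <- s].
    by move=> _ /mapP[p ps ->] /=; apply: Xs.
  by rewrite big_map big_distrr /=; apply: eq_bigr => p _; rewrite mulrA.
Qed.

Lemma mem_ideal_gen X x : X x -> ideal_gen X x.
Proof.
by move=> Xx; exists [:: (1, x)]; [move=> p; rewrite inE => /eqP-> | rewrite big_seq1 mul1r].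
Qed.

Lemma ideal_gen_sub X I x :
  is_ideal I -> (forall y, X y -> I y) -> ideal_gen X x -> I x.
Proof.
move=> iI XI [s Xs ->]; apply: is_ideal_sum => // p ps _.
by have [_ _ iM] := iI; apply/iM/XI/Xs.
Qed.

Lemma ideal_of_seq0 (x : R) : ideal_of_seq [::] x <-> x = 0.
Proof.
split=> [|->]; last by have [] := is_ideal_gen (fun y => y \in ([::] : seq R)).
by apply: (ideal_gen_sub (I := fun y => y = 0)) => //;
  split=> // [? ? -> ->|? ? ->]; rewrite ?addr0 ?mulr0.
Qed.

Lemma ideal_of_seq1 (f x : R) : ideal_of_seq [:: f] x <-> exists g, x = f * g.
Proof.
split.
  apply: (ideal_gen_sub (I := fun y => exists g, y = f * g)).
    split=> [|_ _ [g ->] [h ->]|a _ [g ->]].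
    - by exists 0; rewrite mulr0.
    - by exists (g + h); rewrite mulrDr.
    - by exists (a * g); rewrite mulrCA.
  by move=> y; rewrite inE => /eqP ->; exists 1; rewrite mulr1.
case=> g ->; apply: is_idealMr; first exact: is_ideal_gen.
by apply: mem_ideal_gen; rewrite inE.
Qed.

Lemma idealr_is_ideal (J : idealr R) : is_ideal (fun x => x \in J).
Proof. by split=> [|x y|a x]; [exact: idealr0 | exact: rpredD | exact: idealMr]. Qed.

Lemma idealr_of I :
  is_ideal I -> ~ I 1 -> exists J : idealr R, forall x, (x \in J) = `[< I x >].
Proof.
move=> [i0 iD iM] i1; pose S : {pred R} := fun x => `[< I x >].
have cS : idealr_closed S.
  split; rewrite /in_mem /= /S; [exact/asboolP | exact/asboolPn |].
  move=> a u v; rewrite /in_mem /= /S => /asboolP Iu /asboolP Iv.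
  by apply/asboolP/iD => //; apply: iM.
pose Si := GRing.isZmodClosed.Build R S (idealr_closedB cS).
pose Sp := isProperIdeal.Build R S (idealr_closed_nontrivial cS).
pose J : idealr R := HB.pack S Si Sp.
by exists J.
Qed.

Lemma prime_idealr_of I :
    is_ideal I -> ~ I 1 -> (forall x y, I (x * y) -> I x \/ I y) ->
  exists Q : prime_idealr R, forall x, (x \in Q) = `[< I x >].
Proof.
move=> iI i1 iP; have [i0 iD iM] := iI; pose S : {pred R} := fun x => `[< I x >].
have cS : idealr_closed S.
  split; rewrite /in_mem /= /S; [exact/asboolP | exact/asboolPn |].
  move=> a u v; rewrite /in_mem /= /S => /asboolP Iu /asboolP Iv.
  by apply/asboolP/iD => //; apply: iM.
have pS : prime_idealr_closed S.
  move=> x y; rewrite /in_mem /= /S => /asboolP /iP [] Ix; apply/orP; [left|right];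
  exact/asboolP.
pose Si := GRing.isZmodClosed.Build R S (idealr_closedB cS).
pose Sp := isProperIdeal.Build R S (idealr_closed_nontrivial cS).
pose Sq := isPrimeIdealrClosed.Build R S pS.
pose J : prime_idealr R := HB.pack S Si Sp Sq.
by exists J.
Qed.

(** An ideal maximal among those that contain I and miss T is prime: were neither x nor y in it,
    adjoining x and adjoining y would each produce an element of T, and the product of these two
    lies in the ideal as soon as x * y does. *)
Lemma prime_avoiding I T :
    is_ideal I -> T 1 -> (forall x y, T x -> T y -> T (x * y)) ->
    (forall x, I x -> ~ T x) ->
  exists Q : prime_idealr R,
    (forall x, I x -> x \in Q) /\ (forall x, T x -> x \notin Q).
Proof.
move=> iI T1 TM IT.
pose P (A : set R) := A = set0 \/
  [/\ is_ideal A, forall x, I x -> A x & forall x, A x -> ~ T x].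
have PI : P I by right.
have [F FP Ftot|A [PA Amax]] := @Zorn_bigcup R P.
  have [[A0 FA0 [x0 A0x0]]|Fno] := pselect (exists2 A, F A & exists x, A x); last first.
    left; apply/seteqP; split=> // x [A FA Ax]; apply: Fno; exists A => //.
    by exists x.
  have FN0 A x : F A -> A x ->
      [/\ is_ideal A, forall x, I x -> A x & forall x, A x -> ~ T x].
    by move=> FA Ax; case: (FP A FA) => // A_0; move: Ax; rewrite A_0.
  right; split; first split.
  - by exists A0 => //; have [[]] := FN0 _ _ FA0 A0x0.
  - move=> x y [A FA Ax] [B FB By]; case: (Ftot _ _ FA FB) => AB.
      by exists B => //; have [[_ iD _] _ _] := FN0 _ _ FB By; apply: iD => //; apply: AB.
    by exists A => //; have [[_ iD _] _ _] := FN0 _ _ FA Ax; apply: iD => //; apply: AB.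
  - move=> a x [A FA Ax]; exists A => //.
    by have [[_ _ iM] _ _] := FN0 _ _ FA Ax; apply: iM.
  - by move=> x Ix; exists A0 => //; have [_ IA _] := FN0 _ _ FA0 A0x0; apply: IA.
  - by move=> x [A FA Ax]; have [_ _ AT] := FN0 _ _ FA Ax; apply: AT.
have [iA IA AT] : [/\ is_ideal A, forall x, I x -> A x & forall x, A x -> ~ T x].
  case: PA => // A0; exfalso; apply: (Amax I) => //; rewrite A0; split=> //.
  by move=> I0; have [i0 _ _] := iI; apply: (I0 0).
have [a0 aD aM] := iA.
pose add y : R -> Prop := fun x => exists2 a, A a & exists b, x = a + b * y.
have add_ideal y : is_ideal (add y).
  split=> [|_ _ [a Aa [b ->]] [c Ac [d ->]]|r _ [a Aa [b ->]]].
  - by exists 0 => //; exists 0; rewrite mul0r addr0.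
  - by exists (a + c); [apply: aD | exists (b + d); ring].
  - by exists (r * a); [apply: aM | exists (r * b); ring].
have meet y : ~ A y -> exists2 t, T t & add y t.
  move=> Ay; apply: contrapT => no; apply: (Amax (add y)).
    split=> [x Ax|sub]; first by exists x => //; exists 0; ring.
    by apply/Ay/sub; exists 0 => //; exists 1; ring.
  right; split=> // [x /IA Ax|x addx Tx]; last by apply: no; exists x.
  by exists x => //; exists 0; ring.
have [|x y Axy|Q QA] := prime_idealr_of iA.
- by move=> /AT; apply.
- apply: contrapT => /not_orP[/meet[t Tt [a Aa [b et]]] /meet[s Ts [c Ac [d es]]]].
  apply: (AT (t * s)); last exact: TM.
  have -> : t * s = (c + d * y) * a + (b * x) * c + (b * d) * (x * y).
    by rewrite et es; ring.
  by apply: (aD); [apply: (aD) => //; apply: (aM)|apply: (aM)].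
exists Q; split=> x.
  by move=> /IA Ax; rewrite QA; apply/asboolP.
by move=> Tx; rewrite QA; apply/asboolPn => /AT; apply.
Qed.

Lemma prime_chain_nat (d : nat) (Q : nat -> prime_idealr R) :
    (forall i, (i < d)%N -> {subset Q i <= Q i.+1} /\
       exists2 x, x \in Q i.+1 & x \notin Q i) ->
  prime_chain R d.
Proof.
move=> step; exists (fun i => Q i) => i j; have := ltn_ord j; rewrite ltnS.
elim: {j}(j : nat) => // j IH jd; rewrite ltnS leq_eqVlt => /orP[/eqP->|ij].
  exact: step.
have [sij [x xj xi]] := IH (ltnW jd) ij; have [sj _] := step j jd.
by split=> [y /sij/sj //|]; exists x => //; apply: sj.
Qed.

(* A prime containing the regular element x is not minimal: it contains a     *)
(* prime disjoint from the products of powers of x with elements outside it.  *)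
Lemma regular_sequence_chain (s : seq R) : regular_sequence s -> prime_chain R (size s).
Proof.
move=> [s1 reg].
suff chain j : (j <= size s)%N -> exists Q : nat -> prime_idealr R,
    (forall x, ideal_of_seq (take (size s - j) s) x -> x \in Q 0) /\
    forall i, (i < j)%N -> {subset Q i <= Q i.+1} /\
      exists2 x, x \in Q i.+1 & x \notin Q i.
  by have [Q [_ Qstep]] := chain _ (leqnn (size s)); apply: prime_chain_nat Qstep.
elim: j => [|j IH] js.
  have [||x y|x|Q [IQ _]] := @prime_avoiding (ideal_of_seq s) (fun x => x = 1).
  - exact: is_ideal_gen.
  - by [].
  - by move=> -> ->; rewrite mulr1.
  - by move=> sx x1; move: sx; rewrite x1.
  - by exists (fun=> Q); split=> // x; rewrite subn0 take_size => /IQ.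
have [Q [Q0 Qstep]] := IH (ltnW js).
set i := (size s - j.+1)%N.
have eI : (size s - j)%N = i.+1 by rewrite /i subnSK.
have si : (i < size s)%N by rewrite /i -subSn // subSS leq_subr.
rewrite eI in Q0.
pose T x := exists l : nat, exists2 t, t \notin Q 0 & x = s`_i ^+ l * t.
have QI x : ideal_of_seq (take i s) x -> ideal_of_seq (take i.+1 s) x.
  apply: ideal_gen_sub; first exact: is_ideal_gen.
  move=> y yi; apply: mem_ideal_gen; rewrite (take_nth 0) // mem_rcons inE.
  by rewrite yi orbT.
have [||x y|x|Q' [IQ TQ]] := @prime_avoiding (ideal_of_seq (take i s)) T.
- exact: is_ideal_gen.
- by exists 0, 1; rewrite ?idealr1 ?expr0 ?mul1r.
- move=> [l [t tQ ->]] [l' [t' tQ' ->]]; exists (l + l')%N, (t * t').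
    by rewrite prime_idealrM negb_or tQ.
  by rewrite exprD; ring.
- move=> Ix [l [t tQ ex]]; move: Ix; rewrite {}ex.
  (* Regularity strips the power of the entry of index [i], which leaves [t] in [Q 0], against its
     choice. *)
  elim: l => [|l IHl]; last by rewrite exprS -mulrA => /(reg _ _ si).
  by rewrite expr0 mul1r => /QI/Q0; apply/negP.
exists (fun a => if a is a'.+1 then Q a' else Q'); split=> // -[|a] aj; last exact: Qstep.
split=> [x|].
  by apply: contraLR => xQ; apply: TQ; exists 0, x; rewrite ?expr0 ?mul1r.
exists s`_i.
  by apply: Q0; apply: mem_ideal_gen; rewrite (take_nth 0) // mem_rcons inE eqxx.
by apply: TQ; exists 1, 1; rewrite ?idealr1 ?expr1 ?mulr1.
Qed.

End IdealPredicates.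

(** * Localization *)

Section LocalizationTheory.
Set Implicit Arguments.
Unset Strict Implicit.
Import GRing.Theory.
Local Open Scope ring_scope.

Variables (R : comNzRingType) (P : prime_idealr R).
Local Notation RP := (localization P).

Definition to_loc (a : R) : RP := loc (a, den1 P).

Fact to_loc_zmod_morphism : zmod_morphism to_loc.
Proof.
move=> a b; transitivity (loc_add (to_loc a) (loc_opp (to_loc b))); last by [].
by rewrite /to_loc loc_oppE loc_addE; apply: eq_loc => /=; ring.
Qed.

Fact to_loc_monoid_morphism : monoid_morphism to_loc.
Proof.
split=> // a b; transitivity (loc_mul (to_loc a) (to_loc b)); last by [].
by rewrite /to_loc loc_mulE; apply: eq_loc => /=; ring.
Qed.

HB.instance Definition _ := GRing.isZmodMorphism.Build R RP to_loc to_loc_zmod_morphism.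
HB.instance Definition _ := GRing.isMonoidMorphism.Build R RP to_loc to_loc_monoid_morphism.

Lemma to_loc_eq0 a : to_loc a = 0 <-> exists2 s, s \notin P & s * a = 0.
Proof.
transitivity (to_loc a = loc_zero P); first by [].
rewrite /to_loc /loc_zero locP /=; split=> -[s sP e]; exists s => //; move: e;
  by rewrite mulr1 mul0r mulr0.
Qed.

Lemma to_loc_fraction (z : RP) :
  exists a s, s \notin P /\ z * to_loc s = to_loc a.
Proof.
rewrite -(locK z); case: (repr z) => a [s sP]; exists a, s; split=> //.
transitivity (loc_mul (loc (a, exist _ s sP)) (to_loc s)); first by [].
by rewrite /to_loc loc_mulE; apply: eq_loc => /=; ring.
Qed.

Lemma to_loc_inv s : s \notin P -> exists z, z * to_loc s = 1.
Proof.
move=> sP; exists (loc (1, exist _ s sP)).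
transitivity (loc_mul (loc (1, exist _ s sP)) (to_loc s)); first by [].
by rewrite /to_loc loc_mulE; apply: eq_loc => /=; ring.
Qed.

Lemma to_loc_reg s (x y : RP) : s \notin P -> to_loc s * x = to_loc s * y -> x = y.
Proof.
move=> /to_loc_inv[z zs] e.
by rewrite -[x]mul1r -[y]mul1r -zs -!mulrA e.
Qed.

(** Denominators lie outside P, hence outside Q, and can be cancelled in Q by primality; so the
    ideal of fractions with numerator in Q contracts back to Q. *)
Lemma extend_prime (Q : R -> Prop) :
    is_ideal Q -> (forall x, Q x -> x \in P) ->
    (forall x y, Q (x * y) -> Q x \/ Q y) ->
  exists QP : prime_idealr RP, forall a, (to_loc a \in QP) = `[< Q a >].
Proof.
move=> iQ QP pQ; have [q0 qD qM] := iQ.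
have Qs s a : s \notin P -> Q (s * a) -> Q a.
  by move=> sP /pQ[/QP|//]; rewrite (negPf sP).
pose E (z : RP) := exists a s, [/\ Q a, s \notin P & z * to_loc s = to_loc a].
have EQ a : E (to_loc a) -> Q a.
  case=> b [s [Qb sP]]; rewrite -rmorphM /= => /eqP; rewrite -subr_eq0 -rmorphB /=.
  move=> /eqP/to_loc_eq0[t tP e]; apply: (Qs (t * s)).
    exact: notin_primeM.
  rewrite [X in Q X](_ : _ = t * (a * s - b) + t * b); last by ring.
  by rewrite e add0r; apply: qM.
have iE : is_ideal E.
  split.
  - by exists 0, 1; rewrite idealr1 mul0r rmorph0.
  - move=> x y [a [s [Qa sP ea]]] [b [t [Qb tP eb]]].
    exists (t * a + s * b), (s * t); split; first by apply: (qD); apply: (qM).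
      exact: notin_primeM.
    by rewrite rmorphD !rmorphM /= -ea -eb; ring.
  - move=> z x [a [s [Qa sP ea]]]; have [b [t [tP eb]]] := to_loc_fraction z.
    exists (b * a), (t * s); split; first exact: qM.
      exact: notin_primeM.
    by rewrite !rmorphM /= -ea -eb; ring.
have [|x y [c [r [Qc rP ec]]]|K EK] := prime_idealr_of iE.
- by rewrite -(rmorph1 to_loc) => /EQ/QP; rewrite idealr1.
- have [a [s [sP ea]]] := to_loc_fraction x; have [b [t [tP eb]]] := to_loc_fraction y.
  have /pQ[Qa|Qb] : Q (a * b).
    apply: (Qs r) => //; apply: EQ; exists (s * t * c), 1; split=> //.
    + exact: qM.
    + by rewrite idealr1.
    + by rewrite !rmorphM /= -ea -eb -ec rmorph1; ring.
  + by left; exists a, s.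
  + by right; exists b, t.
exists K => a; rewrite EK; apply/asboolP/asboolP => [/EQ //|Qa].
by exists a, 1; rewrite idealr1 rmorph1 mulr1.
Qed.

(** A fraction with numerator outside P is a unit, so every proper ideal lies in the extension of P;
    this gives both maximality and uniqueness. *)
Lemma localization_local :
  exists2 M : idealr RP, local_ring M & forall a, (to_loc a \in M) = (a \in P).
Proof.
have [|||M MP] := @extend_prime (fun a => a \in P).
- exact: idealr_is_ideal.
- by [].
- by move=> x y; rewrite prime_idealrM => /orP.
have {}MP a : (to_loc a \in M) = (a \in P) by rewrite MP asboolb.
have MI (I : idealr RP) : {subset I <= M}.
  move=> z zI; have [a [s [sP e]]] := to_loc_fraction z.
  have [aP|aP] := boolP (a \in P).
    have [w ws] := to_loc_inv sP.
    have -> : z = w * to_loc a by rewrite -e mulrCA ws mulr1.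
    by rewrite idealMr // MP.
  have [w wa] := to_loc_inv aP; move: (idealMr (w * to_loc s) zI).
  by rewrite -mulrA [to_loc s * z]mulrC e wa idealr1.
exists M => //; split=> [J _|N maxN]; first exact: MI.
by move=> z; apply/idP/idP; [apply: MI | apply: (maxN M); apply: MI].
Qed.

End LocalizationTheory.

(** * The Hilbert basis theorem *)

Section HilbertBasis.
Set Implicit Arguments.
Unset Strict Implicit.
Import GRing.Theory.
Local Open Scope ring_scope.

(** Unlike [noetherian], this speaks of predicates and admits the unit ideal, so that preimages and
    ideals of leading coefficients fit without a proof of properness. *)
Definition ideals_fin_gen (R : comNzRingType) : Prop :=
  forall I : R -> Prop, is_ideal I ->
  exists2 s : seq R, (forall x, x \in s -> I x) & forall x, I x -> ideal_of_seq s x.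

Lemma ideals_fin_gen_noetherian (R : comNzRingType) : ideals_fin_gen R -> noetherian R.
Proof.
move=> fg J; have [s sJ Js] := fg _ (idealr_is_ideal J).
exists s => x; split; first exact: Js.
by apply: (ideal_gen_sub (I := fun x => x \in J)) => //; apply: idealr_is_ideal.
Qed.

Lemma ideals_fin_gen_surj (R S : comNzRingType) (f : {rmorphism R -> S}) :
  (forall y, exists x, f x = y) -> ideals_fin_gen R -> ideals_fin_gen S.
Proof.
move=> fsurj fg I iI; have [i0 iD iM] := iI.
have [|s sI Is] := fg (fun x => I (f x)).
  split=> [|x y Ix Iy|a x Ix]; first by rewrite rmorph0.
    by rewrite rmorphD; apply: iD.
  by rewrite rmorphM; apply: iM.
exists [seq f x | x <- s] => [_ /mapP[x /sI Ix ->] //|y].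
have [x <-] := fsurj y => /Is.
apply: (ideal_gen_sub (I := fun x => ideal_of_seq [seq f x | x <- s] (f x))).
  have [j0 jD jM] := is_ideal_gen (fun z => z \in [seq f x | x <- s]).
  split=> [|u v Iu Iv|a u Iu]; first by rewrite rmorph0.
    by rewrite rmorphD; apply: jD.
  by rewrite rmorphM; apply: jM.
by move=> z zs; apply: mem_ideal_gen; apply: map_f.
Qed.

Lemma ideals_fin_gen_field (k : fieldType) : ideals_fin_gen k.
Proof.
move=> I iI; have [i0 iD iM] := iI.
have [[x [Ix x0]]|no] := pselect (exists x, I x /\ x != 0).
  exists [:: x] => [y|y _]; first by rewrite inE => /eqP->.
  by apply/ideal_of_seq1; exists (x^-1 * y); rewrite mulVKf.
exists [::] => // x Ix; apply/ideal_of_seq0/eqP/negP => /negP x0.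
by apply: no; exists x.
Qed.

Lemma ideal_of_seq_subset (R : comNzRingType) (s t : seq R) x :
  {subset s <= t} -> ideal_of_seq s x -> ideal_of_seq t x.
Proof.
move=> st; apply: ideal_gen_sub; first exact: is_ideal_gen.
by move=> y /st yt; apply: mem_ideal_gen.
Qed.

(** Powers of ['X] bring the nonzero generators to the common length N; a combination of leading
    coefficients is then the coefficient at [N.-1] of the same combination of polynomials. *)
Lemma lead_coef_ideal (R : comNzRingType) (s : seq {poly R}) (N : nat) (c : R) :
    (forall h, h \in s -> size h <= N)%N ->
    ideal_of_seq [seq lead_coef h | h <- s] c ->
  exists2 g, ideal_of_seq s g & (size g <= N)%N /\ g`_N.-1 = c.
Proof.
move=> sN.
have [j0 jD jM] := is_ideal_gen (fun h => h \in s).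
apply: (ideal_gen_sub (I := fun c =>
  exists2 g, ideal_of_seq s g & (size g <= N)%N /\ g`_N.-1 = c)).
  split=> [|_ _ [g Ig [gN <-]] [h Ih [hN <-]]|a _ [g Ig [gN <-]]].
  - by exists 0; rewrite ?size_poly0 ?coef0.
  - exists (g + h); first exact: jD.
    by rewrite coefD (leq_trans (size_polyD _ _)) // geq_max gN.
  - exists (a%:P * g); first exact: jM.
    by rewrite coefCM mul_polyC (leq_trans (size_scale_leq _ _)).
move=> _ /mapP[h hs ->].
have [->|h0] := eqVneq h 0.
  by exists 0; rewrite ?size_poly0 ?coef0 ?lead_coef0.
exists ('X^(N - size h) * h); first by apply/jM/mem_ideal_gen.
have := sN h hs; have : (0 < size h)%N by rewrite lt0n size_poly_eq0.
move=> h_gt0 hN; split.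
  by rewrite mulrC size_mulXn // subnK.
rewrite mulrC coefMXn lead_coefE.
have -> : (N.-1 < N - size h)%N = false.
  by move: h_gt0 hN; lia.
by congr nth; move: h_gt0 hN; lia.
Qed.

(** Hilbert's argument: otherwise, keep adjoining an element of I of least size outside the ideal
    generated so far. The ideal L of all leading coefficients obtained is already reached at a
    finite stage K, so the next element f can be lowered by an element of stage K, against the
    minimality of its size. *)
Lemma ideals_fin_gen_poly (R : comNzRingType) :
  ideals_fin_gen R -> ideals_fin_gen {poly R}.
Proof.
move=> fg I iI; apply: contrapT => nofg; have [i0 iD iM] := iI.
have next (s : seq {poly R}) : exists f : {poly R},
    (forall x, x \in s -> I x) ->
    [/\ I f, ~ ideal_of_seq s f &
        forall g, I g -> ~ ideal_of_seq s g -> (size f <= size g)%N].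
  have [sI|] := pselect (forall x, x \in s -> I x); last by exists 0.
  have [f [If nf]] : exists f, I f /\ ~ ideal_of_seq s f.
    apply: contrapT => no; apply: nofg; exists s => // x Ix.
    by apply: contrapT => nx; apply: no; exists x.
  pose p N := `[< exists f, [/\ I f, ~ ideal_of_seq s f & size f = N] >].
  have exN : exists N, p N by exists (size f); apply/asboolP; exists f.
  have [N /asboolP[h [Ih nh sh]] Nmin] := ex_minnP exN.
  exists h => _; split=> // g Ig ng; rewrite sh; apply: Nmin.
  by apply/asboolP; exists g.
have [F FP] := choice next.
pose S n := iter n (fun s => rcons s (F s)) [::].
have SI n x : x \in S n -> I x.
  elim: n x => // n IH x /=; rewrite mem_rcons inE => /orP[/eqP->|/IH//].
  by have [] := FP _ IH.
have Smono n m : (n <= m)%N -> {subset S n <= S m}.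
  elim: m => [|m IH]; first by rewrite leqn0 => /eqP->.
  rewrite leq_eqVlt => /orP[/eqP->//|/IH nm] x /nm xm.
  by rewrite /= mem_rcons inE xm orbT.
have Ssize n h : h \in S n -> (size h <= size (F (S n)))%N.
  elim: n => // n IH /=; rewrite mem_rcons inE.
  have [Fn nFn _] := FP _ (SI n.+1).
  have {}nFn : ~ ideal_of_seq (S n) (F (S n.+1)).
    by move=> /(ideal_of_seq_subset (Smono _ _ (leqnSn n))).
  have [_ _ Fmin] := FP _ (SI n); have := Fmin _ Fn nFn.
  by move=> le /orP[/eqP->//|/IH h_le]; apply: leq_trans le.
pose L c := exists n, ideal_of_seq [seq lead_coef h | h <- S n] c.
have LS n m c : (n <= m)%N -> ideal_of_seq [seq lead_coef h | h <- S n] c ->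
    ideal_of_seq [seq lead_coef h | h <- S m] c.
  move=> nm; apply: ideal_of_seq_subset => _ /mapP[h hn ->].
  by apply/map_f/(Smono _ _ nm).
have iL : is_ideal L.
  split=> [|x y [n nx] [m my]|a x [n nx]].
  - by exists 0; have [] := is_ideal_gen (fun x => x \in ([::] : seq R)).
  - exists (maxn n m).
    have [_ + _] := is_ideal_gen (fun x => x \in [seq lead_coef h | h <- S (maxn n m)]).
    by apply; [apply: LS nx; rewrite leq_maxl | apply: LS my; rewrite leq_maxr].
  - exists n.
    by have [_ _] := is_ideal_gen (fun x => x \in [seq lead_coef h | h <- S n]); apply.
have [t tL Lt] := fg _ iL.
have [K tK] : exists K, forall x, x \in t ->
    ideal_of_seq [seq lead_coef h | h <- S K] x.
  elim: t tL {Lt} => [|x t IH] tL; first by exists 0.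
  have [|K tK] := IH; first by move=> y yt; apply: tL; rewrite inE yt orbT.
  have [n nx] : L x by apply: tL; rewrite inE eqxx.
  exists (maxn n K) => y; rewrite inE => /orP[/eqP->|/tK].
    by apply: LS nx; rewrite leq_maxl.
  by apply: LS; rewrite leq_maxr.
have [FI nF Fmin] := FP _ (SI K); set f := F (S K) in FI nF Fmin.
have Lf : ideal_of_seq [seq lead_coef h | h <- S K] (lead_coef f).
  apply: (@ideal_gen_sub _ (fun x => x \in t)); first exact: is_ideal_gen.
    exact: tK.
  apply: Lt; exists K.+1; apply: mem_ideal_gen; apply: map_f.
  by rewrite /= mem_rcons inE eqxx.
have [g Sg [gf gc]] := lead_coef_ideal (Ssize K) Lf.
have f0 : f != 0.
  apply/eqP => f0; apply: nF; rewrite f0.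
  by have [] := is_ideal_gen (fun h => h \in S K).
have f_gt0 : (0 < size f)%N by rewrite lt0n size_poly_eq0.
suff : (size f <= (size f).-1)%N by rewrite -{1}(prednK f_gt0) ltnn.
apply: leq_trans (Fmin (f - g) _ _) _.
- apply: is_idealB => //; apply: ideal_gen_sub Sg => //; exact: SI.
- move=> Sfg; apply: nF; rewrite -[f](subrK g).
  by have [_ + _] := is_ideal_gen (fun h => h \in S K); apply.
apply/leq_sizeP => j; rewrite leq_eqVlt => /orP[/eqP<-|jf].
  by rewrite coefB gc lead_coefE subrr.
have fj : (size f <= j)%N by rewrite -(prednK f_gt0).
by rewrite coefB !nth_default ?subrr // (leq_trans gf).
Qed.

Lemma mpoly_rmorph_ind (k : fieldType) (n : nat) (R : comNzRingType)
    (phi : {rmorphism {mpoly k[n]} -> R}) (P : R -> Prop) :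
    (forall c : k, P (phi c%:MP)) -> (forall i : 'I_n, P (phi 'X_i)) ->
    (forall x y, P x -> P y -> P (x + y)) -> (forall x y, P x -> P y -> P (x * y)) ->
  forall f, P (phi f).
Proof.
move=> PC PX PD PM f; have P0 : P 0 by rewrite -(rmorph0 phi) -(mpolyC0 n k).
rewrite [f]mpolyE rmorph_sum; apply: (big_ind P P0 PD) => a _.
rewrite -mul_mpolyC rmorphM; apply: (PM); first exact: PC.
have P1 : P 1 by rewrite -(rmorph1 phi) -(mpolyC1 n k).
rewrite mpolyXE_id rmorph_prod; apply: (big_ind P P1 PM) => i _.
by rewrite rmorphXn; elim: (a i) => [|l IH]; rewrite ?expr0 // exprS; apply: (PM).
Qed.

Lemma mpoly_rmorph_eq (k : fieldType) (n : nat) (R : comNzRingType)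
    (f g : {rmorphism {mpoly k[n]} -> R}) :
    (forall c : k, f c%:MP = g c%:MP) -> (forall i : 'I_n, f 'X_i = g 'X_i) ->
  f =1 g.
Proof.
move=> fgC fgX p; rewrite [p]mpolyE !rmorph_sum; apply: eq_bigr => a _.
rewrite -mul_mpolyC !rmorphM fgC; congr (_ * _).
rewrite mpolyXE_id !rmorph_prod; apply: eq_bigr => i _.
by rewrite !rmorphXn fgX.
Qed.

(** The tower adjoins one polynomial variable at a time and only records a morphism to S whose image
    contains the constants and the first m variables; at m = n it is surjective. *)
Lemma ideals_fin_gen_mpoly (k : fieldType) (n : nat) : ideals_fin_gen {mpoly k[n]}.
Proof.
pose S : comNzRingType := {mpoly k[n]}.
suff tower m : (m <= n)%N -> exists (T : comNzRingType) (f : {rmorphism T -> S}),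
    [/\ ideals_fin_gen T, forall c : k, exists x, f x = c%:MP &
        forall i : 'I_n, (i < m)%N -> exists x, f x = 'X_i].
  have [T [f [fg fC fX]]] := tower n (leqnn n).
  apply: ideals_fin_gen_surj fg.
  apply: (mpoly_rmorph_ind (phi := idfun) (P := fun q => exists x, f x = q)) => //.
  - by move=> i; apply: fX.
  - by move=> _ _ [x <-] [y <-]; exists (x + y); rewrite rmorphD.
  - by move=> _ _ [x <-] [y <-]; exists (x * y); rewrite rmorphM.
elim: m => [|m IH] mn.
  exists k, (@mpolyC n k); split=> [|c|//]; first exact: ideals_fin_gen_field.
  by exists c.
have [T [f [fg fC fX]]] := IH (ltnW mn).
exists {poly T}, (horner_eval ('X_(Ordinal mn) : S) \o map_poly f); split.
- exact: ideals_fin_gen_poly.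
- by move=> c; have [x <-] := fC c; exists x%:P; rewrite /= map_polyC /horner_eval hornerC.
- move=> i; rewrite ltnS leq_eqVlt => /orP[/eqP im|/fX[x <-]].
    exists 'X; rewrite /= map_polyX /horner_eval hornerX.
    by congr 'X_ _; apply: val_inj.
  by exists x%:P; rewrite /= map_polyC /horner_eval hornerC.
Qed.

End HilbertBasis.

(** * Residue fields generated by two elements *)

Section PolynomialLemmas.
Set Implicit Arguments.
Unset Strict Implicit.
Import GRing.Theory.
Local Open Scope ring_scope.

(** Descending induction on i: once the coefficients of W above i are in J, the coefficient of F * W
    at deg F + i is, modulo J, the leading coefficient of F times that of W at i. *)
Lemma coef_mul_ideal (R : comNzRingType) (J : R -> Prop) (F W : {poly R}) :
    is_ideal J -> (forall z, J (lead_coef F * z) -> J z) ->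
    (forall i, ((size F).-1 <= i)%N -> J (F * W)`_i) ->
  forall i, J W`_i.
Proof.
move=> iJ Jlead FW; have [j0 jD jM] := iJ; set d := (size F).-1.
suff H n i : (size W <= i + n)%N -> J W`_i by move=> i; apply: (H (size W)); lia.
elim: n i => [|n IH] i Wi; first by rewrite nth_default // -[i]addn0.
apply: Jlead; have := FW (d + i)%N (leq_addr _ _).
rewrite coefM (bigD1 (inord d)) //= inordK; last by lia.
rewrite addKn lead_coefE -/d => JS.
rewrite -[F`_d * _](addrK
  (\sum_(j < (d + i).+1 | j != inord d) F`_j * W`_(d + i - j))).
apply: is_idealB => //; apply: is_ideal_sum => // j _ jd.
have {}jd : (j != d :> nat).
  by apply: contra jd => /eqP jd; apply/eqP/ord_inj; rewrite inordK; [exact: jd|lia].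
case: (ltngtP j d) jd => // jd _.
  by apply/jM/IH; lia.
by rewrite [F`_j]nth_default ?mul0r //; apply: leq_trans jd; apply: leqSpred.
Qed.

(** If x is transcendental, y satisfies a polynomial F over k[x] with leading coefficient c, and an
    inverse of an element of k[x] can only have divisors of powers of c in its denominator. But 1 +
    x c is coprime to c and not constant. *)
Lemma zariski_two_generators (k : fieldType) (K : comNzRingType)
    (iota : {rmorphism k -> K}) (x y : K) :
    (forall z : K, z != 0 -> exists w, z * w = 1) ->
    (forall z : K, exists F : {poly {poly k}},
       z = (map_poly (fun p => (map_poly iota p).[x]) F).[y]) ->
  integralOver iota x.
Proof.
move=> Kinv Kgen; apply: contrapT => ninteg.
pose ev0 : {rmorphism {poly k} -> K} := horner_eval x \o map_poly iota.
pose ev : {rmorphism {poly {poly k}} -> K} := horner_eval y \o map_poly ev0.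
have {}Kgen z : exists F, z = ev F by exact: Kgen.
have ev0_neq0 h : h != 0 -> ev0 h != 0.
  move=> h0; apply/eqP => eh; apply: ninteg.
  exists ((lead_coef h)^-1 *: h).
    by rewrite monicE lead_coefZ mulVf // lead_coef_eq0.
  rewrite map_polyZ rootE hornerZ [X in _ * X](_ : _ = ev0 h); last by [].
  by rewrite eh mulr0.
have evC a : ev a%:P = ev0 a by rewrite /= map_polyC /horner_eval hornerC.
have ev0X : ev0 'X = x by rewrite /= map_polyX /horner_eval hornerX.
(* The inverse of x, written as a polynomial in y over k[x], gives a relation; its constant
   coefficient takes the value -1 at 0. *)
have [G0 eG0] : exists F, ev F = 0 /\ F != 0.
  have x0 : x != 0.
    by rewrite -ev0X; apply: ev0_neq0; rewrite polyX_eq0.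
  have [w xw] := Kinv _ x0; have [G eG] := Kgen w.
  exists ('X%:P * G - 1); split.
    by rewrite rmorphB rmorphM rmorph1 -eG evC ev0X xw subrr.
  apply/eqP => /(congr1 (fun F : {poly {poly k}} => (F`_0).[0])).
  by rewrite coefB coefCM coef1 coef0 !hornerE; apply/eqP; rewrite oppr_eq0 oner_eq0.
pose p N := `[< exists F, [/\ ev F = 0, F != 0 & size F = N] >].
have exN : exists N, p N by exists (size G0); apply/asboolP; exists G0; case: eG0.
have [N /asboolP[F [eF F0 sF]] Nmin] := ex_minnP exN.
have Fmin H : ev H = 0 -> (size H < size F)%N -> H = 0.
  move=> eH; rewrite sF ltnNge; apply: contraNeq => H0; apply: Nmin.
  by apply/asboolP; exists H.
have sF1 : (1 < size F)%N.
  rewrite ltnNge; apply/negP => /size1_polyC FC.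
  move: eF F0; rewrite FC evC => e0.
  by rewrite polyC_eq0 => /ev0_neq0/eqP.
set c := lead_coef F; pose h := 1 + 'X * c.
have c0 : c != 0 by rewrite lead_coef_eq0.
have sh : (1 < size h)%N.
  rewrite /h addrC size_polyDl mulrC size_mulX // ?size_poly1.
    by rewrite ltnS lt0n size_poly_eq0.
  by rewrite ltnS lt0n size_poly_eq0.
have h0 : h != 0 by rewrite -size_poly_eq0 -lt0n ltnW.
have hc : coprimep h c.
  by apply/Bezout_eq1_coprimepP; exists (1, - 'X) => /=; rewrite /h; ring.
have [w hw] := Kinv _ (ev0_neq0 _ h0); have [G eG] := Kgen w.
pose H := 1 - h%:P * G.
have eH : ev H = 0.
  by rewrite /H rmorphB rmorphM rmorph1 -eG evC hw subrr.
(* Pseudo-division: the remainder of a power of c times H also vanishes at y, so it is 0 by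
   minimality of F. *)
have := Pdiv.Idomain.divp_eq H F; rewrite -/c.
set r := _ ^+ _; set W := H %/ F => eW.
have modF0 : H %% F = 0.
  apply: Fmin; last by rewrite ltn_modp.
  have : ev (r *: H) = ev (W * F + H %% F) by rewrite eW.
  by rewrite -mul_polyC rmorphD !rmorphM eH eF !mulr0 add0r => <-.
rewrite modF0 addr0 mulrC in eW.
have iJ : is_ideal (fun z : {poly k} => h %| z).
  by split=> [|u v|u v]; [exact: dvdp0 | exact: dvdp_add | exact: dvdp_mull].
(* In positive degrees the coefficients of H are multiples of h, hence all those of W are; the
   constant coefficient then shows that h divides a power of c. *)
have JW i : h %| W`_i.
  apply: (coef_mul_ideal (F := F) iJ) => [z|j jF]; first by rewrite Gauss_dvdpr.
  rewrite -eW coefZ coefB coef1 coefCM.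
  have j1 : (0 < j)%N by apply: leq_trans jF; rewrite -subn1 subn_gt0.
  rewrite eqn0Ngt j1 /=.
  by rewrite sub0r mulrN dvdpNr dvdp_mull // dvdp_mulr.
have : h %| r * (1 - h * G`_0).
  have -> : r * (1 - h * G`_0) = (r *: H)`_0 by rewrite coefZ coefB coef1 coefCM.
  by rewrite eW coefM big_ord1 dvdp_mull.
rewrite mulrBr mulr1 mulrCA dvdp_subl ?dvdp_mulr // => hr.
have hr1 : coprimep h r by rewrite coprimep_expr.
move: hr; rewrite -[r]mulr1 Gauss_dvdpr // dvdp1 => /eqP h1.
by rewrite h1 in sh.
Qed.

End PolynomialLemmas.

(** * Monomial ideals *)

Section MonomialIdeals.
Set Implicit Arguments.
Unset Strict Implicit.
Import GRing.Theory.
Local Open Scope ring_scope.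

Variables (k : fieldType) (n : nat).
Local Notation S := {mpoly k[n]}.
Implicit Types (B : 'X_{1..n} -> bool) (f g : S) (e T : {set 'I_n}) (a b : 'X_{1..n}).

(* The monomial ideal is given by the set B of the monomials outside it. *)
Definition monomial_ideal B f : Prop := forall a, B a -> f@_a = 0.

Definition lower_set B : Prop := forall a b, B (a + b)%MM -> B a.

Lemma monomial_idealP B : lower_set B -> is_ideal (monomial_ideal B).
Proof.
move=> lB; split=> [a _|f g If Ig a Ba|f g Ig a Ba]; first by rewrite mcoeff0.
  by rewrite mcoeffD If ?Ig ?addr0.
rewrite mcoeffM big1 // => -[b c] /= /eqP eabc; rewrite Ig ?mulr0 //.
by apply: (lB _ b); rewrite addmC -eabc.
Qed.

Lemma monomial_ideal_sub B (I : S -> Prop) f :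
    is_ideal I -> (forall a, ~~ B a -> I 'X_[a]) -> monomial_ideal B f -> I f.
Proof.
move=> iI IX Jf; rewrite [f]mpolyE; apply: is_ideal_sum => // a af _.
rewrite -mul_mpolyC; have [_ _] := iI; apply; apply: IX; apply/negP => /Jf fa.
by move: af; rewrite mcoeff_msupp fa eqxx.
Qed.

Lemma mem_monomial_ideal B a : ~~ B a -> monomial_ideal B 'X_[a].
Proof.
by move=> nB b Bb; rewrite mcoeffX; case: eqP nB => // ->; rewrite Bb.
Qed.

Lemma monomial_idealX B a : monomial_ideal B 'X_[a] -> ~~ B a.
Proof.
move=> Ia; apply/negP => /Ia; rewrite mcoeffX eqxx; apply/eqP; exact: oner_neq0.
Qed.

(** The set e need not be an edge: [set0] gives the total degree, hence the powers of the ideal of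
    the origin, and singletons give the primes in between. *)
Definition weight e a : nat := \sum_(t in ~: e) a t.

Lemma weightD e a b : weight e (a + b)%MM = (weight e a + weight e b)%N.
Proof. by rewrite -big_split; apply: eq_bigr => t _; rewrite mnmDE. Qed.

Lemma weightU e t : weight e U_(t)%MM = (t \notin e).
Proof.
rewrite /weight; have [te|te] := boolP (t \in e).
  rewrite big1 // => s; rewrite inE mnm1E => se.
  by case: eqP => // ets; rewrite -ets te in se.
rewrite (bigD1 t) ?inE //= mnm1E eqxx big1 ?addn0 // => s /andP[_].
by rewrite mnm1E eq_sym => /negPf->.
Qed.

Lemma weight_Mn e t l : weight e (U_(t) *+ l)%MM = (l * (t \notin e))%N.
Proof.
by elim: l => [|l IH]; rewrite ?mulmS ?weightD ?IH ?weightU ?mulSn // /weight big1 // => i _;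
  rewrite mulm0n mnm0E.
Qed.

Lemma weight_subset (e e' : {set 'I_n}) a : e' \subset e -> (weight e a <= weight e' a)%N.
Proof.
move=> ee'; rewrite /weight [X in (_ <= X)%N](big_setID (~: e)) /=.
by rewrite (setIidPr _) ?leq_addr // setCS.
Qed.

Lemma weight_lower e m : lower_set (fun a => weight e a < m)%N.
Proof. by move=> a b; rewrite weightD; lia. Qed.

Lemma weight_ideal e m : is_ideal (monomial_ideal (fun a => weight e a < m)%N).
Proof. exact/monomial_idealP/weight_lower. Qed.

Lemma weight_gt0 e a : (0 < weight e a)%N ->
  exists t b, t \notin e /\ a = (U_(t) + b)%MM.
Proof.
rewrite lt0n sum_nat_eq0 => /forallPn[t]; rewrite negb_imply inE => /andP[te at0].
exists t, (a - U_(t))%MM; split=> //; rewrite addmC submK //.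
apply/mnm_lepP => s; rewrite mnm1E; case: eqP => // <-.
by rewrite lt0n.
Qed.

Lemma weight_idealM e l l' f g :
    monomial_ideal (fun a => weight e a < l)%N f ->
    monomial_ideal (fun a => weight e a < l')%N g ->
  monomial_ideal (fun a => weight e a < l + l')%N (f * g).
Proof.
move=> If Ig a al; rewrite mcoeffM big1 // => -[b c] /= /eqP eabc.
have {}al : (weight e b + weight e c < l + l')%N by rewrite -weightD -eabc.
have [bl|bl] := ltnP (weight e b) l; first by rewrite If ?mul0r.
by rewrite Ig ?mulr0 //; lia.
Qed.

Lemma weight_idealX e l f :
    monomial_ideal (fun a => weight e a < 1)%N f ->
  monomial_ideal (fun a => weight e a < l)%N (f ^+ l).
Proof.
move=> If; elim: l => [|l IH]; first by move=> a; rewrite ltn0.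
by rewrite exprS -add1n; apply: weight_idealM.
Qed.

Lemma edge_primeE i j f :
  edge_prime k i j f <-> monomial_ideal (fun a => weight [set i; j] a < 1)%N f.
Proof.
split.
  apply: ideal_gen_sub; first exact: weight_ideal.
  move=> _ [t [ti tj ->]]; apply: mem_monomial_ideal.
  by rewrite weightU !inE (negPf ti) (negPf tj).
apply: monomial_ideal_sub; first exact: is_ideal_gen.
move=> a; rewrite -leqNgt => /weight_gt0[t [b [te ->]]].
rewrite mpolyXD; apply: is_idealMr; first exact: is_ideal_gen.
by apply: mem_ideal_gen; exists t; move: te; rewrite !inE negb_or => /andP[].
Qed.

Lemma ideal_pow_edge_prime i j m f :
  ideal_pow (edge_prime k i j) m f <->
  monomial_ideal (fun a => weight [set i; j] a < m)%N f.
Proof.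
have ipow l : is_ideal (ideal_pow (edge_prime k i j) l).
  by case: l => [|l]; [split | exact: is_ideal_gen].
elim: m f => [|m IH] f; first by split.
split.
  apply: ideal_gen_sub; first exact: weight_ideal.
  move=> _ [g [h [/edge_primeE Ig /IH Ih ->]]]; rewrite -add1n.
  exact: weight_idealM.
apply: monomial_ideal_sub => // a; rewrite -leqNgt => am.
have [|t [b [te eab]]] := @weight_gt0 [set i; j] a; first by lia.
rewrite eab mpolyXD; apply: mem_ideal_gen; exists 'X_t, 'X_[b]; split=> //.
  by apply/edge_primeE; apply: mem_monomial_ideal; rewrite weightU te.
by apply/IH/mem_monomial_ideal; move: am; rewrite eab weightD weightU te; lia.
Qed.

(** Here v is a unit at the origin. By induction on the degree of a: the coefficient at a of (v -
    v(0)) * h involves only coefficients of h at proper divisors, which vanish. *)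
Lemma local_monomial_ideal B (v h : S) :
  lower_set B -> v@_0 != 0 -> monomial_ideal B (v * h) -> monomial_ideal B h.
Proof.
move=> lB v0 Ivh a; elim: {a}(mdeg a).+1 {-2}a (ltnSn (mdeg a)) => // d IH a ad Ba.
pose v' := v - (v@_0)%:MP.
have v'h : (v' * h)@_a = 0.
  rewrite mcoeffM big1 // => -[b c] /= /eqP eabc.
  have [b0|b0] := eqVneq (b : 'X_{1..n}) 0%MM.
    by rewrite b0 mcoeffB mcoeffC eqxx mulr1 subrr mul0r.
  rewrite [h@_c]IH ?mulr0 //.
    have e : mdeg a = (mdeg b + mdeg c)%N by rewrite -mdegD -eabc.
    have : mdeg b != 0%N by rewrite mdeg_eq0.
    by lia.
  by apply: (lB _ b); rewrite addmC -eabc.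
have := Ivh a Ba; rewrite -[v](subrK (v@_0)%:MP) -/v' mulrDl mcoeffD v'h add0r mcoeffCM.
by move/eqP; rewrite mulf_eq0 (negPf v0) => /eqP.
Qed.

(** The ideal is the kernel of the endomorphism [psi] that kills the variables outside e, and S is a
    domain. *)
Lemma weight_prime e f g :
  monomial_ideal (fun a => weight e a < 1)%N (f * g) ->
  monomial_ideal (fun a => weight e a < 1)%N f \/
  monomial_ideal (fun a => weight e a < 1)%N g.
Proof.
pose psi : {rmorphism S -> S} :=
  mmap (@mpolyC n k) (fun t => if t \in e then 'X_t else 0).
have psiX a : psi 'X_[a] = if (weight e a < 1)%N then 'X_[a] else 0.
  rewrite [LHS]mmapX /mmap1; case: ifP => [|/negbT].
    rewrite ltnS leqn0 sum_nat_eq0 => /forallP a0; rewrite mpolyXE_id.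
    apply: eq_bigr => t _; case: ifP => // te.
    by have := a0 t; rewrite inE te => /eqP->; rewrite !expr0.
  rewrite -leqNgt => /weight_gt0[t [b [te ->]]].
  by rewrite (bigD1 t) //= (negPf te) mnmDE mnm1E eqxx add1n exprS !mul0r.
have substC' c : psi c%:MP = c%:MP by exact: mmapC.
have psiE f' : monomial_ideal (fun a => weight e a < 1)%N f' <-> psi f' = 0.
  have coefE a : (weight e a < 1)%N -> (psi f')@_a = f'@_a.
    move=> ea; transitivity (\sum_(b <- msupp f') f'@_b * (b == a)%:R).
      rewrite [in LHS](mpolyE f') rmorph_sum raddf_sum; apply: eq_bigr => b _ /=.
      rewrite -mul_mpolyC [mmap _ _ _](rmorphM psi) -/(psi _) psiX substC'.
      rewrite mcoeffCM; congr (_ * _).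
      case: ifP => eb; first by rewrite mcoeffX.
      by rewrite mcoeff0; case: eqP eb => // ->; rewrite ea.
    rewrite [in RHS](mpolyE f') raddf_sum; apply: eq_bigr => b _ /=.
    by rewrite mcoeffZ mcoeffX.
  split=> [If|e0 a ea]; last by rewrite -coefE // e0 mcoeff0.
  apply/eqP; rewrite [f']mpolyE rmorph_sum big_seq big1 // => a af.
  rewrite -mul_mpolyC rmorphM psiX; case: ifP => [/If fa|]; last by rewrite mulr0.
  by move: af; rewrite mcoeff_msupp fa eqxx.
by rewrite !psiE rmorphM => /eqP; rewrite mulf_eq0 => /orP[]/eqP; [left|right].
Qed.

Definition in_symbolic (G : {set {set 'I_n}}) (m : nat) f : Prop :=
  forall e, e \in G -> monomial_ideal (fun a => weight e a < m)%N f.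

Lemma in_symbolic_ideal (G : {set {set 'I_n}}) (m : nat) : is_ideal (in_symbolic G m).
Proof.
split=> [e eG|f g If Ig e eG|f g Ig e eG]; have [i0 iD iM] := weight_ideal e m.
- exact: i0.
- by apply: iD; [exact: If | exact: Ig].
- by apply: iM; exact: Ig.
Qed.

Lemma symbolic_powerE (G : {set {set 'I_n}}) (m : nat) f :
    (forall e, e \in G -> #|e| = 2%N) ->
  symbolic_power k G m f <->
  in_symbolic G m f.
Proof.
move=> G2; split=> [If e eG|If i j ijG]; last exact/ideal_pow_edge_prime/If.
have /eqP/cards2P[i [j [ij eE]]] := G2 e eG.
by rewrite eE in eG *; apply/ideal_pow_edge_prime/If.
Qed.

Definition subst (h : 'I_n -> {poly S}) : {rmorphism S -> {poly S}} :=
  mmap (@polyC S \o @mpolyC n k) h.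

Lemma substC h c : subst h c%:MP = c%:MP%:P.
Proof. exact: mmapC. Qed.

Lemma substX h i : subst h 'X_i = h i.
Proof. by rewrite /= mmapX mmap1U. Qed.

Lemma subst_retract h f : (forall i, (h i).[0] = 'X_i) -> (subst h f)`_0 = f.
Proof.
move=> h0; rewrite -horner_coef0.
apply: (@mpoly_rmorph_eq _ _ _ (horner_eval (0 : S) \o subst h) idfun).
  by move=> c; rewrite /= [mmap _ _ _]substC /horner_eval hornerC.
by move=> i; rewrite /= [mmap _ _ _]substX; apply: h0.
Qed.

Definition erase T a : 'X_{1..n} := [multinom (if i \in T then 0%N else a i) | i < n].

Lemma weight_erase e T a : T \subset e -> weight e (erase T a) = weight e a.
Proof.
move=> /subsetP Te; apply: eq_bigr => t; rewrite inE mnmE => te.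
by case: ifP => // /Te; rewrite (negPf te).
Qed.

(** The condition on [erase] means that the ideal is generated by monomials in the variables outside
    T, which the substitution fixes. *)
Lemma subst_monomial_ideal B T (h : 'I_n -> {poly S}) f :
    lower_set B -> (forall a, B (erase T a) = B a) ->
    (forall i, i \notin T -> h i = ('X_i)%:P) ->
  monomial_ideal B f -> forall i, monomial_ideal B (subst h f)`_i.
Proof.
move=> lB BT hT If.
have iB := monomial_idealP lB.
apply: (monomial_ideal_sub (I := fun g => forall i, monomial_ideal B (subst h g)`_i) _ _ If).
  have [i0 iD iM] := iB; split=> [i|g g' Ig Ig' i|g g' Ig i].
  - by rewrite rmorph0 coef0.
  - by rewrite (rmorphD (subst h)) coefD; apply: iD; [exact: Ig | exact: Ig'].
  - rewrite (rmorphM (subst h)) coefM; apply: (is_ideal_sum iB) => j _ _.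
    by apply: iM; exact: Ig.
move=> a nBa i; rewrite [subst h _]mmapX /mmap1 (bigID (mem T)) /= mulrC.
rewrite (_ : \prod_(i0 < n | i0 \notin T) h i0 ^+ a i0 = ('X_[erase T a])%:P).
  by rewrite coefCM; apply: (is_idealMr _ iB); apply: mem_monomial_ideal; rewrite BT.
rewrite mpolyXE_id [in RHS](bigID (mem T)) /= [X in X * _]big1 ?mul1r => [|j jT];
  last by rewrite /erase mnmE jT expr0.
rewrite rmorph_prod; apply: eq_bigr => j jT.
by rewrite hT // /erase mnmE (negPf jT) rmorphXn.
Qed.

(** Evaluation at 0 undoes the substitution, so it suffices to cancel the image of F modulo J; its
    leading coefficient is a unit. The square in the hypothesis allows for the signs that slides
    produce. *)
Lemma subst_regular (J : S -> Prop) (h : 'I_n -> {poly S}) F f :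
    is_ideal J -> (forall g, J g -> forall i, J (subst h g)`_i) ->
    (forall i, (h i).[0] = 'X_i) -> (lead_coef (subst h F)) ^+ 2 = 1 ->
  J (F * f) -> J f.
Proof.
move=> iJ Jh h0 lead1 /Jh JFf; rewrite -(subst_retract f h0).
apply: (coef_mul_ideal (F := subst h F)) => // [z|i _]; last by rewrite -rmorphM.
rewrite -[z in X in _ -> X]mul1r -lead1 expr2 -mulrA.
by have [_ _] := iJ; apply.
Qed.

Definition poly_at (p : {poly k}) (w : S) : S := (map_poly (@mpolyC n k) p).[w].

Lemma subst_poly_at h p w :
  subst h (poly_at p w) = map_poly (@mpolyC n k) p \Po subst h w.
Proof.
rewrite /poly_at -horner_map -map_poly_comp /comp_poly -map_poly_comp; congr _.[_].
by apply: eq_map_poly => c /=; rewrite [mmap _ _ _]substC.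
Qed.

Lemma lead_coef_subst_poly_at h (p : {poly k}) w :
    p \is monic -> (1 < size (subst h w))%N -> (lead_coef (subst h w)) ^+ 2 = 1 ->
  (lead_coef (subst h (poly_at p w))) ^+ 2 = 1.
Proof.
move=> pm sw lw; rewrite subst_poly_at lead_coef_comp // lead_coef_map (monicP pm).
by rewrite rmorph1 mul1r exprAC lw expr1n.
Qed.

Definition usum : S := \sum_i 'X_i.
(** The exponents are positive and distinct, so that after a slide the top powers of Y from the two
    moved variables cannot cancel, in any characteristic. *)
Definition vsum : S := \sum_(i < n) 'X_i ^+ i.+1.

Definition shift_var (t : 'I_n) (i : 'I_n) : {poly S} :=
  ('X_i)%:P + (if i == t then 'X else 0).

Definition slide_vars (s t : 'I_n) (i : 'I_n) : {poly S} :=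
  ('X_i)%:P + (if i == t then 'X else if i == s then - 'X else 0).

Lemma shift_regular B t (p : {poly k}) f :
    lower_set B -> (forall a, B (erase [set t] a) = B a) -> p \is monic ->
  monomial_ideal B (poly_at p usum * f) -> monomial_ideal B f.
Proof.
move=> lB BT pm; apply: (@subst_regular _ (shift_var t)).
- exact: monomial_idealP.
- move=> g; apply: (subst_monomial_ideal lB BT) => i.
  by rewrite inE /shift_var => /negPf->; rewrite addr0.
- by move=> i; rewrite /shift_var hornerD hornerC; case: ifP; rewrite ?hornerX ?horner0 addr0.
have uE : subst (shift_var t) usum = 'X + usum%:P.
  rewrite /usum !rmorph_sum /= addrC; under eq_bigr do rewrite [mmap _ _ _]substX.
  by rewrite /shift_var big_split /= -big_mkcond big_pred1_eq.
apply: lead_coef_subst_poly_at => //; rewrite uE ?size_XaddC //.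
by rewrite lead_coefXaddC expr1n.
Qed.

Lemma lead_coef_addl_sqr (p q : {poly S}) (c : S) (i j : nat) :
    size p = i.+2 -> size q = j.+2 -> i != j ->
    lead_coef p ^+ 2 = 1 -> lead_coef q ^+ 2 = 1 ->
  (1 < size (p + q + c%:P)%R)%N /\ lead_coef (p + q + c%:P) ^+ 2 = 1.
Proof.
wlog ij : p q i j / (i < j)%N => [hwlog sp sq ij lp lq|].
  case: (ltngtP i j) ij => // ij _.
    by apply: (hwlog _ _ _ _ ij sp sq _ lp lq); rewrite neq_ltn ij ?orbT.
  by rewrite (addrC p); apply: (hwlog _ _ _ _ ij sq sp _ lq lp); rewrite neq_ltn ij ?orbT.
move=> sp sq _ lp lq; have lt : (size (p + c%:P)%R < size q)%N.
  apply: leq_ltn_trans (size_polyD _ _) _; rewrite sp sq gtn_max.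
  by rewrite !ltnS ij /= (leq_trans (size_polyC_leq1 c)).
by rewrite addrAC lead_coefDr // addrC size_polyDl // sq.
Qed.

(** The slide fixes the sum of the variables, so it preserves the ideal J generated by the monomial
    ideal and p(u), while q(v) becomes monic in Y up to sign; hence q(v) is regular modulo J. *)
Lemma slide_regular B s t (p q : {poly k}) f :
    s != t -> lower_set B -> (forall a, B (erase [set s; t] a) = B a) ->
    q \is monic ->
    (exists g, monomial_ideal B (poly_at q vsum * f - poly_at p usum * g)) ->
  exists g, monomial_ideal B (f - poly_at p usum * g).
Proof.
move=> st lB BT qm [g Ig]; pose P := poly_at p usum.
have iB := monomial_idealP lB; have [i0 iD iM] := iB.
pose J f := exists g, monomial_ideal B (f - P * g).
have iJ : is_ideal J.
  split=> [|f1 f2 [g1 I1] [g2 I2]|a f1 [g1 I1]].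
  - by exists 0; rewrite mulr0 subr0.
  - by exists (g1 + g2); rewrite mulrDr opprD addrACA; apply: iD.
  - by exists (a * g1); rewrite mulrCA -mulrBr; apply: iM.
have uE : subst (slide_vars s t) usum = usum%:P.
  rewrite /usum !rmorph_sum /=; under eq_bigr do rewrite [mmap _ _ _]substX.
  rewrite /slide_vars big_split /= -[RHS]addr0; congr (_ + _).
  rewrite (bigD1 t) //= eqxx (bigD1 s) //= (negPf st) eqxx.
  by rewrite big1 ?addr0 ?subrr ?addr0 // => i /andP[/negPf-> /negPf->].
have PE : subst (slide_vars s t) P = P%:P.
  rewrite /P subst_poly_at uE /poly_at /comp_poly.
  by rewrite -map_poly_comp -horner_map -map_poly_comp.
have JX g1 : monomial_ideal B g1 -> forall i, monomial_ideal B (subst (slide_vars s t) g1)`_i.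
  apply: (subst_monomial_ideal lB BT) => i.
  by rewrite !inE negb_or /slide_vars => /andP[/negPf-> /negPf->]; rewrite addr0.
apply: (@subst_regular J (slide_vars s t) (poly_at q vsum)) => //.
- move=> f1 [g1 I1] i; exists (subst (slide_vars s t) g1)`_i.
  by rewrite -coefCM -coefB -PE -rmorphM -rmorphB; apply: JX.
- move=> i; rewrite /slide_vars hornerD hornerC.
  by do 2?case: ifP => _; rewrite ?hornerN ?hornerX ?horner0 ?oppr0 addr0.
- suff [sv lv] : (1 < size (subst (slide_vars s t) vsum))%N /\
    lead_coef (subst (slide_vars s t) vsum) ^+ 2 = 1.
    exact: lead_coef_subst_poly_at.
  have [c ->] : exists c : S, subst (slide_vars s t) vsum =
      (('X_s)%:P - 'X) ^+ s.+1 + (('X_t)%:P + 'X) ^+ t.+1 + c%:P.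
    exists (\sum_(i < n | (i != t) && (i != s)) 'X_i ^+ i.+1).
    rewrite /vsum [LHS]rmorph_sum [X in _ + X]rmorph_sum /=.
    rewrite (bigD1 t) //= (bigD1 s) //= addrA [X in X + _]addrC.
    have vE i : mmap (@polyC S \o @mpolyC n k) (slide_vars s t) ('X_i ^+ i.+1) =
        slide_vars s t i ^+ i.+1.
      by rewrite -/(subst _ _) rmorphXn; congr (_ ^+ _); apply: substX.
    rewrite !vE /slide_vars eqxx (negPf st) eqxx; congr (_ + _).
    apply: eq_bigr => i /andP[it is_]; rewrite vE /slide_vars (negPf it) (negPf is_).
    by rewrite addr0 rmorphXn.
  apply: lead_coef_addl_sqr.
  + have -> : ('X_s)%:P - 'X = - ('X - ('X_s)%:P) :> {poly S} by rewrite opprB.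
    rewrite exprNn -signr_odd.
    by case: odd; rewrite ?mul1r ?mulN1r ?size_polyN size_exp_XsubC.
  + by rewrite addrC -[_%:P]opprK -rmorphN size_exp_XsubC.
  + exact: st.
  + have -> : ('X_s)%:P - 'X = - ('X - ('X_s)%:P) :> {poly S} by rewrite opprB.
    rewrite lead_coef_exp lead_coefN lead_coefXsubC -exprM mulnC exprM.
    by rewrite sqrrN !expr1n.
  + by rewrite addrC lead_coef_exp lead_coefXaddC !expr1n.
- by exists g.
Qed.

End MonomialIdeals.

(** * The dimension bound *)

Section DimensionBound.
Set Implicit Arguments.
Unset Strict Implicit.
Import GRing.Theory.
Local Open Scope ring_scope.

Lemma linear_dependence (k : fieldType) (T U : finType) (M : T -> U -> k) :
    (#|U| < #|T|)%N ->
  exists v : T -> k, (exists t, v t != 0) /\ forall u, \sum_t v t * M t u = 0.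
Proof.
move=> UT; pose A := \matrix_(i < #|T|, j < #|U|) M (enum_val i) (enum_val j).
have kerA : kermx A != 0.
  rewrite kermx_eq0 /row_free; apply/eqP => rA.
  by have := rank_leq_col A; rewrite rA leqNgt UT.
pose w := nz_row (kermx A).
have w0 : w != 0 by rewrite nz_row_eq0.
have wA : w *m A = 0 by apply/sub_kermxP/nz_row_sub.
exists (fun t => w 0 (enum_rank t)); split.
  have [j wj] := rV0Pn _ w0.
  by exists (enum_val j); rewrite enum_valK.
move=> u; transitivity ((w *m A) 0 (enum_rank u)); last by rewrite wA mxE.
rewrite mxE (reindex (@enum_val T predT)) /=; last first.
  by apply/onW_bij/enum_val_bij.
by apply: eq_bigr => i _; rewrite enum_valK !mxE enum_rankK.
Qed.

(** Factors ['X] can be stripped from F since x is outside Q; the nonzero constant coefficient that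
    appears is a multiple of x modulo Q, so its image is in Q'. Each strict inclusion thus
    eliminates one variable from an algebraic relation. *)
Lemma prime_step (D R : comNzRingType) (phi : {rmorphism D -> R})
    (Q Q' : prime_idealr R) (x : R) (F : {poly D}) :
    {subset Q <= Q'} -> x \in Q' -> x \notin Q -> F != 0 ->
    (map_poly phi F).[x] \in Q ->
  exists2 d, d != 0 & phi d \in Q'.
Proof.
move=> QQ' xQ' xQ; elim/poly_ind: F => [|F c IH]; first by rewrite eqxx.
rewrite rmorphD rmorphM /= map_polyX map_polyC hornerMXaddC /=.
have [->|c0 _ FQ] := eqVneq c 0.
  rewrite !rmorph0 !addr0 prime_idealrM (negPf xQ) orbF => Fx.
  by apply: IH; apply: contraNneq Fx => ->; rewrite mul0r.
exists c => //; rewrite -[phi c](addKr ((map_poly phi F).[x] * x)).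
by rewrite rpredD ?rpredN ?(QQ' _ FQ) // idealMr.
Qed.

Variables (k : fieldType) (n : nat).
Local Notation S := {mpoly k[n]}.

Definition degree_le (d : nat) (f : S) : Prop := forall a, (d < mdeg a)%N -> f@_a = 0.

Lemma degree_leM d d' (f g : S) :
  degree_le d f -> degree_le d' g -> degree_le (d + d') (f * g).
Proof.
move=> df dg a am; rewrite mcoeffM big1 // => -[b c] /= /eqP eabc.
have {}am : (d + d' < mdeg b + mdeg c)%N by rewrite -mdegD -eabc.
have [bd|bd] := ltnP d (mdeg b); first by rewrite df ?mul0r.
by rewrite dg ?mulr0 //; lia.
Qed.

Lemma degree_leX d (f : S) l : degree_le d f -> degree_le (d * l) (f ^+ l).
Proof.
move=> df; elim: l => [|l IH]; last by rewrite exprS mulnS; apply: degree_leM.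
move=> a; rewrite muln0 expr0 mcoeff1; case: eqP => // ->.
by rewrite mdeg0.
Qed.

(** A count: the N^3 products have degree at most 3DN, and at most ((3D+1)N)^2 monomials in x_i, x_j
    can occur in them modulo the edge prime. This is less than N^3 once N > (3D+1)^2. *)
Lemma mpoly_algebraic_dependence (i j : 'I_n) (f0 f1 f2 : S) : i != j ->
  exists N (v : 'I_N * 'I_N * 'I_N -> k), (exists t, v t != 0) /\
    monomial_ideal (fun a => weight [set i; j] a < 1)%N
      (\sum_t v t *: (f0 ^+ t.1.1 * f1 ^+ t.1.2 * f2 ^+ t.2)).
Proof.
move=> ij; pose D := (msize f0 + msize f1 + msize f2)%N.
have fD f : f \in [:: f0; f1; f2] -> degree_le D f.
  move=> fs a Da; apply/eqP; rewrite mcoeff_eq0; apply: msize_mdeg_ge.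
  by move: fs; rewrite !inE => /or3P[] /eqP->; move: Da; rewrite /D; lia.
have [N ND] : exists N, ((3 * D).+1 * (3 * D).+1 < N)%N.
  by exists ((3 * D).+1 * (3 * D).+1).+1.
pose B := (3 * D * N).+1.
pose mon (t : 'I_N * 'I_N * 'I_N) := f0 ^+ t.1.1 * f1 ^+ t.1.2 * f2 ^+ t.2.
have monB t : degree_le (3 * D * N) (mon t).
  case: t => [[a b] c]; rewrite /mon /= => z.
  have -> : (3 * D * N = D * N + D * N + D * N)%N by rewrite -mulnA !mulSn mul0n addn0 addnA.
  have le (l : 'I_N) f : f \in [:: f0; f1; f2] -> degree_le (D * N) (f ^+ l).
    move=> fs w wD; apply: (degree_leX (l := l) (fD _ fs)).
    by apply: leq_ltn_trans wD; rewrite leq_mul2l (ltnW (ltn_ord l)) orbT.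
  by apply: degree_leM; first apply: degree_leM; apply: le; rewrite !inE eqxx ?orbT.
pose exps (u : 'I_B * 'I_B) : 'X_{1..n} := (U_(i) *+ u.1 + U_(j) *+ u.2)%MM.
have [|v [v0 vM]] := @linear_dependence k _ _ (fun t (u : 'I_B * 'I_B) => (mon t)@_(exps u)).
  rewrite !card_prod !card_ord.
  have N0 : (0 < N)%N by apply: leq_ltn_trans ND.
  have BN : (B <= (3 * D).+1 * N)%N by rewrite /B mulSn -addn1 addnC leq_add2r.
  apply: leq_ltn_trans (leq_mul BN BN) _.
  by rewrite mulnACA -[X in (_ < X)%N]mulnA ltn_mul2r muln_gt0 N0 ND.
exists N, v; split=> // a; rewrite ltnS leqn0 => /eqP wa.
have aE : a = (U_(i) *+ a i + U_(j) *+ a j)%MM.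
  apply/mnmP => t; rewrite mnmDE !mulmnE !mnm1E.
  have [<-|it] := eqVneq i t; first by rewrite eq_sym (negPf ij) mul1n mul0n addn0.
  have [<-|jt] := eqVneq j t; first by rewrite mul1n.
  rewrite !mul0n; move/eqP: wa; rewrite sum_nat_eq0 => /forallP/(_ t)/implyP/(_ _)/eqP->//.
  by rewrite !inE negb_or ![t == _]eq_sym it.
have [aB|aB] := leqP (a i + a j) (3 * D * N).
  have iB : (a i < B)%N by rewrite /B; lia.
  have jB : (a j < B)%N by rewrite /B; lia.
  rewrite aE raddf_sum /= -[RHS](vM (Ordinal iB, Ordinal jB)).
  by apply: eq_bigr => t _; rewrite mcoeffZ.
rewrite raddf_sum /= big1 // => t _; rewrite mcoeffZ monB ?mulr0 //.
by rewrite aE mdegD !mdegMn !mdeg1 !mul1n.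
Qed.

(** Otherwise every edge misses some variable outside Q; the product of the m-th powers of these
    variables is in the symbolic power but not in Q. *)
Lemma prime_contains_edge_prime (G : {set {set 'I_n}}) (m : nat) (Q : S -> Prop) :
    is_ideal Q -> ~ Q 1 -> (forall f g, Q (f * g) -> Q f \/ Q g) ->
    (forall f, in_symbolic G m f -> Q f) ->
  exists2 e, e \in G & forall t, t \notin e -> Q 'X_t.
Proof.
move=> iQ Q1 pQ IQ; apply: contrapT => no.
have QX f l : Q (f ^+ l) -> Q f.
  by elim: l => [/Q1//|l IH]; rewrite exprS => /pQ[//|/IH].
have exg (e : {set 'I_n}) : exists g : S, e \in G ->
    monomial_ideal (fun a => weight e a < m)%N g /\ ~ Q g.
  have [eG|] := boolP (e \in G); last by exists 1.
  have [t [te nt]] : exists t, t \notin e /\ ~ Q 'X_t.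
    apply: contrapT => no2; apply: no; exists e => // t te.
    by apply: contrapT => nt; apply: no2; exists t.
  exists ('X_t ^+ m) => _; split; last by move/QX.
  rewrite mpolyXn; apply: mem_monomial_ideal; rewrite -leqNgt.
  elim: m {IQ} => // m IH; rewrite mulmS weightD weightU te.
  by rewrite add1n ltnS.
have [g gP] := choice exg.
have nQ (r : seq {set 'I_n}) : {subset r <= G} -> ~ Q (\prod_(e <- r) g e).
  elim: r => [_|e r IH rG]; first by rewrite big_nil.
  rewrite big_cons => /pQ[|]; first by have [] := gP e (rG _ (mem_head _ _)).
  by apply: IH => e' e'r; apply: rG; rewrite inE e'r orbT.
apply: (nQ (enum G)) => [e|]; first by rewrite mem_enum.
apply: IQ => e eG; rewrite (big_rem e) ?mem_enum //=.
apply: (is_idealMr _ (weight_ideal k e m)).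
by have [] := gP e eG.
Qed.

(** In a longer chain, numerators f0, f1, f2 witness three strict inclusions. They are algebraically
    dependent modulo an edge prime below the first prime, and three uses of [prime_step] put a
    nonzero constant into the last one. *)
Lemma prime_chain_le2 (G : {set {set 'I_n}}) (m : nat) (R : comNzRingType)
    (phi : {rmorphism S -> R}) (d : nat) :
    (forall e, e \in G -> #|e| = 2%N) ->
    (forall f : S, in_symbolic G m f -> phi f = 0) ->
    (forall z, exists f s w, z * phi s = phi f /\ w * phi s = 1) ->
  prime_chain R d -> (d <= 2)%N.
Proof.
move=> G2 phi0 frac [Q Qchain]; rewrite leqNgt; apply/negP => d3.
pose q l := Q (inord l).
have qstep l : (l < 3)%N -> {subset q l <= q l.+1} /\
    exists f, phi f \in q l.+1 /\ phi f \notin q l.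
  move=> l3; have [|sub [x xq xnq]] := Qchain (inord l) (inord l.+1).
    by rewrite !inordK; lia.
  split=> //; have [f [s [w [xs ws]]]] := frac x.
  exists f; rewrite -xs mulrC idealMr //; split=> //; apply: contra xnq => xsq.
  by rewrite -[x]mul1r -ws -mulrA idealMr.
have [q01 [f0 [f0i f0n]]] := qstep 0 isT.
have [q12 [f1 [f1i f1n]]] := qstep 1 isT.
have [q23 [f2 [f2i f2n]]] := qstep 2 isT.
pose Q0 f := phi f \in q 0.
have iQ0 : is_ideal Q0.
  rewrite /Q0; split=> [|f g If Ig|f g Ig]; first by rewrite rmorph0 idealr0.
    by rewrite rmorphD rpredD.
  by rewrite rmorphM idealMr.
have [||f If|e eG Xe] := @prime_contains_edge_prime G m Q0 iQ0.
- by rewrite /Q0 rmorph1 idealr1.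
- by move=> f g; rewrite /Q0 rmorphM prime_idealrM => /orP.
- by rewrite /Q0 phi0 // idealr0.
have /eqP/cards2P[i [j [ij eE]]] := G2 e eG.
have [N [v [[t0 vt0] vrel]]] := mpoly_algebraic_dependence f0 f1 f2 ij.
pose ev0 : {rmorphism k -> R} := phi \o @mpolyC n k.
pose ev1 : {rmorphism {poly k} -> R} := horner_eval (phi f2) \o map_poly ev0.
pose ev2 : {rmorphism {poly {poly k}} -> R} := horner_eval (phi f1) \o map_poly ev1.
pose ev3 : {rmorphism {poly {poly {poly k}}} -> R} :=
  horner_eval (phi f0) \o map_poly ev2.
(* f0 is the outermost variable because the first inclusion eliminates it. *)
pose F : {poly {poly {poly k}}} :=
  \sum_t ((v t *: 'X^(t.2))%:P * 'X^(t.1.2))%:P * 'X^(t.1.1).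
have F0 : F != 0.
  apply/eqP => /(congr1 (fun H : {poly {poly {poly k}}} =>
    ((H`_(t0.1.1))`_(t0.1.2))`_(t0.2))).
  rewrite !coef0 /F !coef_sum (bigD1 t0) //= big1 => [|t tt0].
    by rewrite !(coefCM, coefXn, coefZ, eqxx, mulr1) addr0; apply/eqP.
  rewrite !(coefCM, coefXn, coefZ).
  case: eqP => e1; last by rewrite mulr0 !coef0.
  rewrite mulr1 !(coefCM, coefXn, coefZ).
  case: eqP => e2; last by rewrite mulr0 !coef0.
  rewrite mulr1 !(coefCM, coefXn, coefZ).
  case: eqP => e3; last by rewrite mulr0.
  case/eqP: tt0; case: t t0 e1 e2 e3 {vt0} => [[a b] c] [[a0 b0] c0] /= e1 e2 e3.
  by congr (_, _, _); apply: val_inj.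
have evF : ev3 F \in q 0.
  have -> : ev3 F = phi (\sum_t v t *: (f0 ^+ t.1.1 * f1 ^+ t.1.2 * f2 ^+ t.2)).
    rewrite !rmorph_sum; apply: eq_bigr => t _.
    rewrite -mul_mpolyC !rmorphM !rmorphXn.
    have ev3C H : ev3 H%:P = ev2 H by rewrite /= map_polyC /horner_eval hornerC.
    have ev2C H : ev2 H%:P = ev1 H by rewrite /= map_polyC /horner_eval hornerC.
    have ev1C c : ev1 c%:P = ev0 c by rewrite /= map_polyC /horner_eval hornerC.
    have ev3X : ev3 'X = phi f0 by rewrite /= map_polyX /horner_eval hornerX.
    have ev2X : ev2 'X = phi f1 by rewrite /= map_polyX /horner_eval hornerX.
    have ev1X : ev1 'X = phi f2 by rewrite /= map_polyX /horner_eval hornerX.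
    rewrite -!mul_polyC !(rmorphM, rmorphXn) !(ev3C, ev2C, ev1C, ev3X, ev2X, ev1X).
    by rewrite [ev0 _]/=; ring.
  apply: (monomial_ideal_sub iQ0 _ vrel) => a; rewrite -eE -leqNgt.
  move=> /weight_gt0[t [b [te ->]]]; rewrite mpolyXD; apply: (is_idealMr _ iQ0).
  exact: Xe.
have [G1 G10 G1q] := prime_step q01 f0i f0n F0 evF.
have [G2' G20 G2q] := prime_step q12 f1i f1n G10 G1q.
have [c c0 cq] := prime_step q23 f2i f2n G20 G2q.
have := idealMr (ev0 c^-1) cq; rewrite -rmorphM mulVf // rmorph1.
by rewrite idealr1.
Qed.

End DimensionBound.

(** * Regular sequences and gluing *)

Section Sufficiency.
Set Implicit Arguments.
Unset Strict Implicit.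
Import GRing.Theory.
Local Open Scope ring_scope.
Local Open Scope quotient_scope.

Lemma localization_regular (R : comNzRingType) (P : prime_idealr R)
    (M : idealr (localization P)) (x y : R) :
    (forall a, (to_loc P a \in M) = (a \in P)) -> x \in P -> y \in P ->
    (forall a, x * a = 0 -> a = 0) ->
    (forall a b, y * a = x * b -> exists c, a = x * c) ->
  regular_in M 2.
Proof.
move=> MP xP yP xreg yreg; pose s := [:: to_loc P x; to_loc P y].
have sM : {subset s <= M} by move=> z; rewrite !inE => /orP[]/eqP->; rewrite MP.
have clear0 t a : t \notin P -> to_loc P t * a = 0 -> a = 0.
  by move=> tP e; apply: (to_loc_reg tP); rewrite e mulr0.
exists s; split=> //; split=> [s1|[|[|//]] z _] /=.
- have : 1 \in M.
    apply: (ideal_gen_sub (I := fun z => z \in M) _ _ s1); last exact: sM.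
    exact: idealr_is_ideal.
  by rewrite idealr1.
- move=> /ideal_of_seq0 xz; apply/ideal_of_seq0.
  have [a [r [rP zr]]] := to_loc_fraction z.
  have /to_loc_eq0[t tP ta] : to_loc P (x * a) = 0 by rewrite rmorphM /= -zr mulrA xz mul0r.
  have a0 : to_loc P a = 0.
    by apply/to_loc_eq0; exists t => //; apply: xreg; rewrite mulrCA.
  by apply: (clear0 r) => //; rewrite mulrC zr.
- move=> /ideal_of_seq1[w yz]; apply/ideal_of_seq1.
  have [a [r [rP zr]]] := to_loc_fraction z; have [b [q [qP wq]]] := to_loc_fraction w.
  have /to_loc_eq0[t tP e] : to_loc P (y * (a * q) - x * (b * r)) = 0.
    rewrite rmorphB !rmorphM /= -zr -wq.
    transitivity (to_loc P r * to_loc P q * (to_loc P y * z - to_loc P x * w)).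
      by ring.
    by rewrite yz subrr mulr0.
  have [|c ec] := yreg (t * (a * q)) (t * (b * r)).
    by apply/eqP; rewrite -subr_eq0 ![_ * (t * _)]mulrCA -mulrBr e.
  have tqrP : t * q * r \notin P by do 2?apply: notin_primeM.
  have [v vt] := to_loc_inv tqrP.
  exists (v * to_loc P c); apply: (to_loc_reg tqrP).
  transitivity (to_loc P (t * (a * q))).
    by rewrite !rmorphM /= -zr; ring.
  rewrite ec rmorphM /= mulrCA; congr (_ * _).
  by rewrite mulrA [_ * v]mulrC vt mul1r.
Qed.

Lemma maximal_ideal_inv (R : comNzRingType) (P : idealr R) (x : R) :
  maximal_ideal P -> x \notin P -> exists y, 1 - x * y \in P.
Proof.
move=> maxP xP; pose I z := exists y, z - x * y \in P.
have iI : is_ideal I.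
  split=> [|u v [y uy] [z vz]|a u [y uy]].
  - by exists 0; rewrite mulr0 subrr idealr0.
  - by exists (y + z); rewrite mulrDr opprD addrACA rpredD.
  - by exists (a * y); rewrite mulrCA -mulrBr idealMr.
apply: contrapT => nI1; have [J JI] := idealr_of iI nI1.
case/negP: xP; apply: (maxP J).
  by move=> z zP; rewrite JI; apply/asboolP; exists 0; rewrite mulr0 subr0.
by rewrite JI; apply/asboolP; exists 1; rewrite mulr1 subrr idealr0.
Qed.

Variables (k : fieldType) (n : nat).
Local Notation S := {mpoly k[n]}.

Lemma residue_integral (R : comNzRingType) (phi : {rmorphism S -> R}) (i j : 'I_n) :
    (forall x : R, x != 0 -> exists y, x * y = 1) ->
    (forall x : R, exists f, phi f = x) ->
    (forall t : 'I_n, t != i -> t != j -> phi 'X_t = 0) ->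
  forall f, integralOver (phi \o @mpolyC n k) (phi f).
Proof.
move=> Rinv phisurj phi0; pose iota : {rmorphism k -> R} := phi \o @mpolyC n k.
(* The condition is symmetric in x and y, so it serves for both x_i and x_j; integral elements are
   closed under sums and products. *)
suff int_ij x y : (forall t : 'I_n, phi 'X_t = 0 \/ (phi 'X_t = x \/ phi 'X_t = y)) ->
    integralOver iota x.
  have cases t : [\/ phi 'X_t = 0, phi 'X_t = phi 'X_i | phi 'X_t = phi 'X_j].
    have [->|ti] := eqVneq t i; first exact: Or32.
    have [->|tj] := eqVneq t j; first exact: Or33.
    by apply: Or31; apply: phi0.
  have int_i : integralOver iota (phi 'X_i).
    by apply: (int_ij _ (phi 'X_j)) => t; case: (cases t); tauto.
  have int_j : integralOver iota (phi 'X_j).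
    by apply: (int_ij _ (phi 'X_i)) => t; case: (cases t); tauto.
  apply: mpoly_rmorph_ind => [c|t|x y|x y].
  - exact: (integral_id iota).
  - by case: (cases t) => -> //; apply: integral0.
  - exact: integral_add.
  - exact: integral_mul.
move=> xy; apply: (@zariski_two_generators _ _ iota x y Rinv) => z.
have [f <-] := phisurj z.
pose ev0 : {rmorphism {poly k} -> R} := horner_eval x \o map_poly iota.
pose ev : {rmorphism {poly {poly k}} -> R} := horner_eval y \o map_poly ev0.
have evC H : ev H%:P = ev0 H by rewrite /= map_polyC /horner_eval hornerC.
have ev0C c : ev0 c%:P = iota c by rewrite /= map_polyC /horner_eval hornerC.
have evX : ev 'X = y by rewrite /= map_polyX /horner_eval hornerX.
have ev0X : ev0 'X = x by rewrite /= map_polyX /horner_eval hornerX.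
suff : exists F, phi f = ev F by case=> F ->; exists F.
apply: (mpoly_rmorph_ind (P := fun z => exists F, z = ev F)) =>
  [c|t|_ _ [F ->] [H ->]|_ _ [F ->] [H ->]].
- by exists c%:P%:P; rewrite evC ev0C.
- case: (xy t) => [->|[->|->]].
  + by exists 0; rewrite rmorph0.
  + by exists 'X%:P; rewrite evC ev0X.
  + by exists 'X; rewrite evX.
- by exists (F + H); rewrite rmorphD.
- by exists (F * H); rewrite rmorphM.
Qed.

Lemma rmorph_poly_at (R : comNzRingType) (phi : {rmorphism S -> R}) p w :
  phi (poly_at p w) = (map_poly (phi \o @mpolyC n k) p).[phi w].
Proof. by rewrite /poly_at -horner_map map_poly_comp. Qed.

Variables (G : {set {set 'I_n}}) (m : nat).
Hypothesis G2 : forall e, e \in G -> #|e| = 2%N.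

Hypothesis connect_through : forall a e e', e \in G -> e' \in G ->
  (weight e a < m)%N -> (weight e' a < m)%N ->
  exists e'', [/\ e'' \in G, (weight e'' a < m)%N, ~~ [disjoint e & e'']
                & ~~ [disjoint e'' & e']].

(** The coefficient at a is copied from any light edge. Two light edges give the same value, since
    each of them meets the third light edge of [connect_through] and [compat] applies twice. *)
Lemma glue (c : {set 'I_n} -> S) :
    (forall e e', e \in G -> e' \in G -> ~~ [disjoint e & e'] ->
      monomial_ideal (fun a => (weight e a < m) && (weight e' a < m))%N (c e - c e')) ->
  exists f, forall e, e \in G -> monomial_ideal (fun a => weight e a < m)%N (f - c e).
Proof.
move=> compat; pose supp := undup (flatten [seq msupp (c e) : seq _ | e <- enum G]).
pose coef a := if [pick e in G | (weight e a < m)%N] is Some e then (c e)@_a else 0.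
exists (\sum_(a <- supp) coef a *: 'X_[a]) => e eG a ea.
have agree e1 e2 : e1 \in G -> e2 \in G -> ~~ [disjoint e1 & e2] ->
    (weight e1 a < m)%N -> (weight e2 a < m)%N -> (c e1)@_a = (c e2)@_a.
  move=> G1 G2' d12 a1 a2; apply/eqP; rewrite -subr_eq0 -mcoeffB.
  by rewrite (compat _ _ G1 G2' d12) ?a1.
have coefE : coef a = (c e)@_a.
  rewrite /coef; case: pickP => [e' /andP[e'G e'a]|/(_ e)]; last by rewrite eG ea.
  have [e'' [e''G e''a d1 d2]] := connect_through e'G eG e'a ea.
  by rewrite (agree e' e'') // (agree e'' e).
rewrite mcoeffB raddf_sum /= -coefE; apply/eqP; rewrite subr_eq0; apply/eqP.
have [a_supp|a_supp] := boolP (a \in supp).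
  rewrite (big_rem a) //= mcoeffZ mcoeffX eqxx mulr1 big_seq_cond big1 ?addr0 // => b.
  rewrite mem_rem_uniq ?undup_uniq // inE andbT => /andP[ba _].
  by rewrite mcoeffZ mcoeffX (negPf ba) mulr0.
rewrite big_seq_cond big1 => [|b].
  rewrite coefE; apply/esym/eqP; rewrite mcoeff_eq0; apply: contra a_supp => ac.
  by rewrite mem_undup; apply/flatten_mapP; exists e; rewrite ?mem_enum.
rewrite andbT => bs; rewrite mcoeffZ mcoeffX; case: eqP => [e'|]; last by rewrite mulr0.
by rewrite -e' bs in a_supp.
Qed.

Lemma usum_regular (p : {poly k}) f :
  p \is monic -> in_symbolic G m (poly_at p (usum k n) * f) -> in_symbolic G m f.
Proof.
move=> pm If e eG; have /eqP/cards2P[i [j [ij eE]]] := G2 eG.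
apply: (shift_regular (t := i) _ _ pm (If e eG)); first exact: weight_lower.
by move=> a; rewrite weight_erase // sub1set eE !inE eqxx.
Qed.

(** Each edge has its own quotient of f by p(u). At meeting edges two quotients differ by an element
    that p(u) multiplies into the sum of the edge powers; shifting a common vertex shows p(u)
    regular there, so the quotients glue. *)
Lemma vsum_regular (p q : {poly k}) f g : p \is monic -> q \is monic ->
    in_symbolic G m (poly_at q (vsum k n) * f - poly_at p (usum k n) * g) ->
  exists h, in_symbolic G m (f - poly_at p (usum k n) * h).
Proof.
move=> pm qm Ifg; set P := poly_at p (usum k n) in Ifg *.
have exc (e : {set 'I_n}) : exists h, e \in G ->
    monomial_ideal (fun a => weight e a < m)%N (f - P * h).
  have [eG|] := boolP (e \in G); last by exists 0.
  have /eqP/cards2P[i [j [ij eE]]] := G2 eG.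
  have [|||h hI] := @slide_regular _ _ (fun a => weight e a < m)%N i j p q f ij _ _ qm.
  - exact: weight_lower.
  - by move=> a; rewrite weight_erase // eE.
  - by exists g; apply: Ifg.
  - by exists h.
have [c cI] := choice exc.
have [e e' eG e'G ee'|h hc] := @glue c.
  have lB : lower_set (fun a : 'X_{1..n} => (weight e a < m) && (weight e' a < m))%N.
    by move=> a b /andP[/weight_lower-> /weight_lower->].
  have /pred0Pn[t /andP[/= te te']] := ee'.
  apply: (shift_regular (t := t) lB _ pm) => [a|a /andP[ea e'a]].
    by rewrite !weight_erase ?sub1set.
  rewrite -/P [_ * _](_ : _ = (f - P * c e') - (f - P * c e)); last by ring.
  by rewrite mcoeffB (cI e') // (cI e) // subrr.
exists h => e eG.
rewrite [X in monomial_ideal _ X](_ : _ = (f - P * c e) - P * (h - c e)); last by ring.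
have iw := weight_ideal k e m; have [_ _ iM] := iw.
apply: (is_idealB iw); first exact: cI.
by apply: iM; apply: hc.
Qed.

End Sufficiency.

(** * Cohen-Macaulayness of the symbolic power *)

Section CohenMacaulay.
Set Implicit Arguments.
Unset Strict Implicit.
Import GRing.Theory.
Local Open Scope ring_scope.
Local Open Scope quotient_scope.

Lemma pi_eq0 (R : comNzRingType) (J : idealr R) x :
  \pi_{ideal_quot J} x = 0 <-> x \in J.
Proof.
rewrite -[x in X in _ <-> X]subr0 Quotient.idealrBE -(rmorph0 \pi_{ideal_quot J}).
by split=> [->|/eqP].
Qed.

Lemma quotient_ideal (R : comNzRingType) (J : idealr R) (Q : R -> Prop) :
    is_ideal Q -> (forall x, x \in J -> Q x) ->
  exists Q' : {ideal_quot J} -> Prop,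
    is_ideal Q' /\ forall x, Q' (\pi_{ideal_quot J} x) <-> Q x.
Proof.
move=> iQ JQ; have [q0 qD qM] := iQ; exists (fun z => Q (repr z)).
have QE x : Q (repr (\pi_{ideal_quot J} x)) <-> Q x.
  have /JQ Qd : repr (\pi_{ideal_quot J} x) - x \in J.
    by rewrite Quotient.idealrBE reprK.
  split=> Qx; last by rewrite -[repr _](subrK x); apply: qD.
  by rewrite -[x](subKr (repr (\pi_{ideal_quot J} x))); apply: is_idealB.
split=> //; split=> [|x y|a x].
- by rewrite -(rmorph0 \pi_{ideal_quot J}) QE.
- rewrite -[x in X in _ -> _ -> X]reprK -[y in X in _ -> _ -> X]reprK => Qx Qy.
  by rewrite -rmorphD QE; apply: qD.
- rewrite -[x in X in _ -> X]reprK -[a]reprK => Qx.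
  by rewrite -rmorphM QE; apply: qM.
Qed.

Variables (k : fieldType) (n : nat) (G : {set {set 'I_n}}) (m : nat).
Local Notation S := {mpoly k[n]}.
Hypothesis G2 : forall e, e \in G -> #|e| = 2%N.

Lemma symbolic_power_proper : G != set0 -> (0 < m)%N -> ~ symbolic_power k G m 1.
Proof.
case/set0Pn=> e eG m0 /(symbolic_powerE m _ G2)/(_ e eG 0%MM).
rewrite /weight big1 => [/(_ m0)/eqP|t _]; last by rewrite mnm0E.
by rewrite mcoeff1 eqxx oner_eq0.
Qed.

Lemma symbolic_power_cohen_macaulay :
    G != set0 -> (0 < m)%N ->
    (forall a e e', e \in G -> e' \in G ->
      (weight e a < m)%N -> (weight e' a < m)%N ->
      exists e'', [/\ e'' \in G, (weight e'' a < m)%N, ~~ [disjoint e & e'']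
                    & ~~ [disjoint e'' & e']]) ->
  cohen_macaulay_ideal (symbolic_power k G m).
Proof.
move=> G0 m0 conn.
have IE f := symbolic_powerE m f G2.
have iI := in_symbolic_ideal k G m.
have [|J JI] := idealr_of iI; first by move/IE; apply: symbolic_power_proper.
have {}JI f : f \in J <-> in_symbolic G m f by rewrite JI; split=> /asboolP.
exists J => [f|]; first by rewrite JI IE.
pose A : comNzRingType := {ideal_quot J}; pose pi : {rmorphism S -> A} := \pi_{ideal_quot J}.
have pi0 f : pi f = 0 <-> in_symbolic G m f by rewrite pi_eq0.
have pisurj (z : A) : exists f, pi f = z by exists (repr z); apply: reprK.
split.
  exact/ideals_fin_gen_noetherian/(ideals_fin_gen_surj pisurj)/ideals_fin_gen_mpoly.
move=> P maxP; have [M localM MP] := localization_local P.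
exists M => //; exists 2.
pose K : comNzRingType := {ideal_quot P}; pose res : {rmorphism A -> K} := \pi_{ideal_quot P}.
pose phi : {rmorphism S -> K} := res \o pi.
have phiP f : phi f = 0 <-> pi f \in P by rewrite /= pi_eq0.
have [e eG Xe] : exists2 e, e \in G & forall t, t \notin e -> phi 'X_t = 0.
  apply: (@prime_contains_edge_prime k n G m (fun f => phi f = 0)).
  - split=> [|f g f0 g0|f g g0]; first exact: rmorph0.
      by rewrite rmorphD f0 g0 addr0.
    by rewrite rmorphM g0 mulr0.
  - by rewrite rmorph1; apply/eqP/oner_neq0.
  - move=> f g /phiP; rewrite rmorphM prime_idealrM => /orP[/phiP|/phiP]; tauto.
  - by move=> f /pi0 pif; rewrite /= pif rmorph0.
have /eqP/cards2P[i [j [ij eE]]] := G2 eG.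
have integ f : integralOver (phi \o @mpolyC n k) (phi f).
  apply: (@residue_integral _ _ _ _ i j) => [x|x|t ti tj].
  - have [y <-] : exists y : A, res y = x by exists (repr x); apply: reprK.
    move=> x0; have yP : y \notin P.
      by apply: contra x0 => /pi_eq0 y0; apply/eqP; exact: y0.
    have [z yz] := maximal_ideal_inv maxP yP.
    exists (res z); apply/esym/eqP; rewrite -subr_eq0 -rmorphM -(rmorph1 res) -rmorphB.
    by apply/eqP/pi_eq0.
  - have [y <-] : exists y : A, res y = x by exists (repr x); apply: reprK.
    by have [f' <-] := pisurj y; exists f'.
  - by apply: Xe; rewrite eE !inE (negPf ti).
(* A monic equation of the residue class of w over k. *)
have poly_in w : exists2 p, p \is monic & pi (poly_at p w) \in P.
  have [p pm /rootP pw] := integ w; exists p => //.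
  by apply/phiP; rewrite rmorph_poly_at.
have [p pm pP] := poly_in (usum k n); have [q qm qP] := poly_in (vsum k n).
have regM : regular_in M 2.
  apply: (localization_regular MP pP qP) => [a|a b].
    have [f <-] := pisurj a; rewrite -rmorphM => /pi0/(usum_regular G2 pm) If.
    exact/pi0.
  have [f <-] := pisurj a; have [g <-] := pisurj b => /eqP.
  rewrite -!rmorphM -subr_eq0 -rmorphB => /eqP/pi0/(vsum_regular G2 conn pm qm)[h Ih].
  exists (pi h); apply/eqP; rewrite -rmorphM -subr_eq0 -rmorphB; exact/eqP/pi0.
have dim2 d : prime_chain (localization P) d -> (d <= 2)%N.
  apply: (@prime_chain_le2 k n G m _ (to_loc P \o pi)) => // [f If|z].
    by rewrite /= ((pi0 f).2 If) rmorph0.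
  have [a [s [sP zs]]] := to_loc_fraction z; have [w ws] := to_loc_inv sP.
  have [f ef] := pisurj a; have [g eg] := pisurj s.
  by exists f, g, w; rewrite /= ef eg.
(* Depth is thus at most dimension, which is at most 2, and [regM] forces equality. *)
have chain e' : regular_in M e' -> prime_chain (localization P) e'.
  by case=> s [<- _ /regular_sequence_chain].
by split; split=> //; [apply: chain | move=> d /chain/dim2].
Qed.

End CohenMacaulay.

(** * The obstruction *)

Section Necessity.
Set Implicit Arguments.
Unset Strict Implicit.
Import GRing.Theory.
Local Open Scope ring_scope.
Local Open Scope quotient_scope.

Section RegularPair.
Variables (R : comNzRingType) (f g : R).
Hypothesis f_reg : forall y, f * y = 0 -> y = 0.
Hypothesis g_reg : forall y z, g * y = f * z -> exists w, y = f * w.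

Lemma regular_cancel x y l : f ^+ l * x = f ^+ l * y -> x = y.
Proof.
move=> e; apply/eqP; rewrite -subr_eq0; apply/eqP.
have : f ^+ l * (x - y) = 0 by rewrite mulrBr e subrr.
elim: l {e} => [|l IH]; first by rewrite mul1r.
by rewrite exprS -mulrA => /f_reg/IH.
Qed.

(** The outer induction strips factors g, the inner one extracts factors f. *)
Lemma regular_pair_exp l l' y z : g ^+ l' * y = f ^+ l * z -> exists w, y = f ^+ l * w.
Proof.
elim: l' y z => [|l' IH] y z; first by rewrite mul1r => ->; exists z.
rewrite exprSr -mulrA => /IH[w]; elim: l y w {IH z} => [|l IHl] y z e.
  by exists y; rewrite mul1r.
have [w yw] : exists w, y = f * w by apply: (g_reg (z := f ^+ l * z)); rewrite e exprS mulrA.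
have [|v wv] := IHl w z.
  by apply: (@regular_cancel _ _ 1); rewrite expr1 mulrCA -yw e exprS mulrA.
by exists v; rewrite yw wv exprS mulrA.
Qed.

(* The condition on a says that the fractions a i / y i agree, i.e., define a  *)
(* section over the open set where some y i is invertible.                     *)
Lemma regular_pair_extend (T : finType) (y a c d : T -> R) (l : nat) :
    (forall i j, y i * a j = y j * a i) ->
    f ^+ l = \sum_i c i * y i -> g ^+ l = \sum_i d i * y i ->
  exists z, forall j, a j = y j * z.
Proof.
(* These are what [f ^+ l * z] and [g ^+ l * z] must be; z is recovered by dividing [bf]. *)
move=> ya fE gE; pose bf := \sum_i c i * a i; pose bg := \sum_i d i * a i.
have bfE j : y j * bf = f ^+ l * a j.
  rewrite fE mulr_sumr mulr_suml; apply: eq_bigr => i _.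
  by rewrite mulrCA ya mulrA.
have bgE j : y j * bg = g ^+ l * a j.
  rewrite gE mulr_sumr mulr_suml; apply: eq_bigr => i _.
  by rewrite mulrCA ya mulrA.
have [|z bz] := @regular_pair_exp l l bf bg.
  rewrite gE mulr_suml.
  under eq_bigr => i _ do rewrite -mulrA bfE mulrCA.
  by rewrite -mulr_sumr.
exists z => j; apply: (@regular_cancel _ _ l).
by rewrite -bfE bz mulrCA.
Qed.

End RegularPair.

Variables (k : fieldType) (n : nat).
Local Notation S := {mpoly k[n]}.

(** Pigeonhole: a monomial of degree above n m has some exponent at least m. *)
Lemma power_in_variable_powers (f : S) m : f@_0 = 0 ->
  ideal_gen (fun h => exists t : 'I_n, h = 'X_t ^+ m) (f ^+ (n * m).+1).
Proof.
move=> f0.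
have If : monomial_ideal (fun a => weight set0 a < 1)%N f.
  move=> a; rewrite ltnS leqn0 sum_nat_eq0 => /forallP a0.
  by rewrite (_ : a = 0%MM) //; apply/mnmP => t; rewrite mnm0E; apply/eqP;
    have := a0 t; rewrite !inE.
apply: monomial_ideal_sub (weight_idealX (l := (n * m).+1) If).
  exact: is_ideal_gen.
move=> a; rewrite -leqNgt => am.
have [t at_] : exists t, (m <= a t)%N.
  apply: contrapT => no; move: am; apply/negP; rewrite -ltnNge ltnS.
  rewrite -[n in (n * m)%N]card_ord -sum_nat_const /weight big_mkcond /=.
  apply: leq_sum => t _; case: ifP => // _; apply: ltnW; rewrite ltnNge.
  by apply/negP => ta; apply: no; exists t.
have -> : a = (U_(t) *+ m + (a - U_(t) *+ m))%MM.
  rewrite addmC submK //; apply/mnm_lepP => s; rewrite mulmnE mnm1E.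
  by case: eqP => [<-|_]; rewrite ?mul1n ?mul0n.
rewrite mpolyXD -mpolyXn; apply: is_idealMr; first exact: is_ideal_gen.
by apply: mem_ideal_gen; exists t.
Qed.

Variables (G : {set {set 'I_n}}) (m : nat) (p q r s : 'I_n).
Hypothesis G2 : forall e, e \in G -> #|e| = 2%N.
Hypothesis pqrs_uniq : uniq [:: p; q; r; s].
Hypothesis pqG : [set p; q] \in G.
Hypothesis rsG : [set r; s] \in G.
Hypothesis prG : [set p; r] \notin G.
Hypothesis psG : [set p; s] \notin G.
Hypothesis m3 : (3 <= m)%N.

(** Its weight is 2 off pq and m - 1 off rs, so both edges are light as m >= 3; the light edges are
    rs and those through p. *)
Let alpha : 'X_{1..n} := (U_(p) *+ m.-1 + U_(r) + U_(s))%MM.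

(** An edge missing i or j gets weight m from the corresponding power. The edge ij itself has i
    different from p, so p and the other one of r, s contribute (m - 1) + 1. *)
Lemma separating_monomial i j : i \notin [:: r; s] -> j \in [:: r; s] ->
  in_symbolic (k := k) G m ('X_i ^+ m * ('X_j ^+ m * 'X_[alpha])).
Proof.
move=> irs jrs e eG; rewrite !mpolyXn -!mpolyXD; apply: mem_monomial_ideal.
rewrite -leqNgt !weightD !weight_Mn !weightU.
have [ie|ie] := boolP (i \in e); last by rewrite muln1 leq_addr.
rewrite muln0 add0n; have [je|je] := boolP (j \in e); last by rewrite muln1 leq_addr.
rewrite muln0 add0n.
have ij : i != j by apply: contraNneq irs => ->.
have eE : e = [set i; j].
  apply/esym/eqP; rewrite eqEcard subUset !sub1set ie je G2 // cards2 ij.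
  by [].
have ip : i != p.
  apply: contraTneq eG => ip; rewrite eE ip; move: jrs; rewrite !inE.
  by case/orP=> /eqP->.
move: pqrs_uniq irs jrs ip; rewrite /= !inE !negb_or eE.
move=> /and4P[/and3P[pq pr ps] /andP[qr qs] rs _] /andP[ir is_] jrs ip; rewrite !inE ![p == _]eq_sym.
have -> : (i == p) = false by apply/negbTE.
case/orP: jrs => /eqP->.
  rewrite eqxx orbT (eq_sym r p) (negPf pr) (eq_sym s i) (negPf is_) (eq_sym s r).
  by rewrite (negPf rs) /= muln1 addn0 addn1 prednK // (leq_trans _ m3).
rewrite eqxx orbT (eq_sym s p) (negPf ps) (eq_sym r i) (negPf ir) (negPf rs) /=.
by rewrite muln1 addn0 addn1 prednK // (leq_trans _ m3).
Qed.

Lemma not_cohen_macaulay : ~ cohen_macaulay_ideal (symbolic_power k G m).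
Proof.
move=> [J JI [_ CM]].
have {}JI f : f \in J <-> in_symbolic G m f by rewrite JI; apply: symbolic_powerE.
pose A : comNzRingType := {ideal_quot J}; pose pi : {rmorphism S -> A} := \pi_{ideal_quot J}.
have pi0 f : pi f = 0 <-> in_symbolic G m f by rewrite pi_eq0.
have pisurj (z : A) : exists f, pi f = z by exists (repr z); apply: reprK.
have quotQ (e : {set 'I_n}) : e \subset [set p; q] -> exists Q : A -> Prop,
    [/\ is_ideal Q, forall x y, Q (x * y) -> Q x \/ Q y &
        forall f, Q (pi f) <-> monomial_ideal (fun a => weight e a < 1)%N f].
  move=> epq; have [|Q [iQ QE]] := @quotient_ideal S J _ (weight_ideal k e 1).
    move=> f /JI/(_ _ pqG) If a ea; apply: If; apply: leq_ltn_trans (ltn_trans ea _).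
      exact: weight_subset.
    by apply: leq_trans m3.
  exists Q; split=> // x y; have [f <-] := pisurj x; have [g <-] := pisurj y.
  rewrite -rmorphM => /QE/weight_prime[]; by [left; apply/QE | right; apply/QE].
have const0 f : monomial_ideal (fun a => weight set0 a < 1)%N f <-> f@_0 = 0.
  split=> [->//|f0 a a0]; first by rewrite /weight big1 // => t _; rewrite mnm0E.
  rewrite (_ : a = 0%MM) //; apply/mnmP => t; rewrite mnm0E; apply/eqP.
  by move: a0; rewrite ltnS leqn0 sum_nat_eq0 => /forallP/(_ t); rewrite !inE.
have [Q0 [iQ0 pQ0 Q0E]] := quotQ set0 (sub0set _).
have {}Q0E f : Q0 (pi f) <-> f@_0 = 0 by rewrite Q0E const0.
have [|P PE] := prime_idealr_of iQ0 _ pQ0.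
  rewrite -(rmorph1 pi) => /Q0E; rewrite mcoeff1 eqxx; apply/eqP/oner_neq0.
have {}PE f : pi f \in P <-> f@_0 = 0 by rewrite PE -Q0E; split=> /asboolP.
have maxP : maximal_ideal P.
  move=> I PI x; have [f <-] := pisurj x => fI.
  apply/PE/eqP; apply: contraT => f0; move: (idealr1 I) => /negP; case.
  have /PE/PI f'I : (f - (f@_0)%:MP)@_0 = 0 by rewrite mcoeffB mcoeffC eqxx mulr1 subrr.
  have /(idealMr (pi ((f@_0)^-1)%:MP)) : pi (f@_0)%:MP \in I.
    by rewrite -[_%:MP](subKr f) rmorphB rpredB.
  by rewrite -rmorphM -mpolyCM mulVf // rmorph1.
have [M localM [d [[_ dim_max] [[sq [sq_size sqM [_ sq_reg]]] _]]]] := CM P maxP.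
have [M' [maxM' _] M'E] := localization_local P.
pose phi : {rmorphism S -> localization P} := to_loc P \o pi.
have phiM f : phi f \in M <-> f@_0 = 0 by rewrite -PE -M'E -(localM.2 M' maxM').
have phi_unit u : u@_0 != 0 -> exists w, w * phi u = 1.
  by move=> u0; apply: to_loc_inv; apply: contra u0 => /PE->.
have phi_frac z : exists f u, u@_0 != 0 /\ z * phi u = phi f.
  have [x [y [yP zy]]] := to_loc_fraction z.
  have [f ef] := pisurj x; have [u eu] := pisurj y.
  exists f, u; split; last by rewrite /= ef eu.
  by apply: contra yP => /eqP u0; rewrite -eu; apply/PE.
have phi0 f : phi f = 0 -> exists2 v, v@_0 != 0 & in_symbolic G m (v * f).
  move=> /to_loc_eq0[y yP yf]; have [v ev] := pisurj y; exists v.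
    by apply: contra yP => /eqP v0; rewrite -ev; apply/PE.
  by apply/pi0; rewrite rmorphM ev.
have extQ (e : {set 'I_n}) : e \subset [set p; q] -> exists Q : prime_idealr (localization P),
    forall f, (phi f \in Q) <-> monomial_ideal (fun a => weight e a < 1)%N f.
  move=> epq; have [Q [iQ pQ QE]] := quotQ e epq.
  have [x Qx|Q' Q'E] := @extend_prime _ P Q iQ _ pQ.
    have [f ef] := pisurj x; move: Qx; rewrite -ef => /QE If; apply/PE/If.
    by rewrite /weight big1 // => t _; rewrite mnm0E.
  by exists Q' => f; rewrite Q'E -QE; split=> /asboolP.
have ext_step (e e' : {set 'I_n}) t (Q Q' : prime_idealr (localization P)) :
    (forall f, (phi f \in Q) <-> monomial_ideal (fun a => weight e a < 1)%N f) ->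
    (forall f, (phi f \in Q') <-> monomial_ideal (fun a => weight e' a < 1)%N f) ->
    e' \subset e -> t \in e -> t \notin e' ->
    {subset Q <= Q'} /\ exists2 x, x \in Q' & x \notin Q.
  move=> QE Q'E ee' te te'; split=> [z zQ|].
    have [f [u [u0 zu]]] := phi_frac z; have [w wu] := phi_unit u u0.
    have /QE If : phi f \in Q by rewrite -zu mulrC idealMr.
    have /Q'E fQ' : monomial_ideal (fun a => weight e' a < 1)%N f.
      by move=> a e'a; apply: If; apply: leq_ltn_trans e'a; apply: weight_subset.
    by rewrite -[z]mul1r -wu -mulrA [_ * z]mulrC zu idealMr.
  exists (phi 'X_t).
    by apply/Q'E; apply: mem_monomial_ideal; rewrite weightU te'.
  by apply/negP => /QE/monomial_idealX; rewrite weightU te.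
have p_pq : [set p] \subset [set p; q] by rewrite sub1set !inE eqxx.
have pq : p != q by move: pqrs_uniq; rewrite /= !inE !negb_or => /andP[/andP[]].
(* The primes of pq, of p alone and of the origin form a chain of length 2, so the regular sequence
   [sq], whose length is the dimension, has two first entries f and g. *)
have [K0 K0E] := extQ [set p; q] (subxx _).
have [K1 K1E] := extQ [set p] p_pq.
have [K2 K2E] := extQ set0 (sub0set _).
have d2 : (2 <= d)%N.
  apply: dim_max; apply: (prime_chain_nat (Q := fun l => nth K2 [:: K0; K1] l)) => -[|[|//]] _.
    by apply: (ext_step _ _ q _ _ K0E K1E) => //; rewrite !inE ?eqxx ?orbT // eq_sym.
  by apply: (ext_step _ _ p _ _ K1E K2E); rewrite ?sub0set // !inE ?eqxx.
pose f := sq`_0; pose g := sq`_1.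
have sq2 : (1 < size sq)%N by rewrite sq_size.
have f_reg y : f * y = 0 -> y = 0.
  move=> fy; have := sq_reg 0 y (ltnW sq2); rewrite take0 => reg.
  by apply/ideal_of_seq0/reg/ideal_of_seq0.
have g_reg y z : g * y = f * z -> exists w, y = f * w.
  move=> gy; have := sq_reg 1 y sq2; rewrite (take_nth 0) ?take0 ?(ltnW sq2) //= => reg.
  by apply/ideal_of_seq1/reg/ideal_of_seq1; exists z.
(* The powers of the variables generate an ideal containing powers of f and g, as
   [regular_pair_extend] requires. *)
have powers x : x \in M -> exists c : 'I_n -> localization P,
    x ^+ (n * m).+1 = \sum_t c t * phi ('X_t ^+ m).
  move=> xM; have [h [u [u0 xu]]] := phi_frac x; have [w wu] := phi_unit u u0.
  have /phiM h0 : phi h \in M by rewrite -xu mulrC idealMr.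
  pose Sp y := exists c : 'I_n -> localization P, y = \sum_t c t * phi ('X_t ^+ m).
  have SpM a y : Sp y -> Sp (a * y).
    case=> c ->; exists (fun t => a * c t).
    by rewrite mulr_sumr; apply: eq_bigr => t _; rewrite mulrA.
  have [c hc] : Sp (phi (h ^+ (n * m).+1)).
    apply: (ideal_gen_sub (I := fun y => Sp (phi y)) _ _ (power_in_variable_powers m h0)).
      split=> [|y z [c yc] [c' zc]|a y Sy].
      - by exists (fun=> 0); rewrite rmorph0 big1 // => t _; rewrite mul0r.
      - exists (fun t => c t + c' t); rewrite rmorphD yc zc -big_split.
        by apply: eq_bigr => t _; rewrite mulrDl.
      - by rewrite rmorphM; apply: SpM.
    move=> _ [t ->]; exists (fun t' => (t' == t)%:R).
    rewrite (bigD1 t) //= eqxx mul1r big1 ?addr0 // => t' /negPf->.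
    by rewrite mul0r.
  have -> : x = w * phi h by rewrite -xu mulrCA wu mulr1.
  by rewrite exprMn -rmorphXn; apply: SpM; exists c.
have [cf fE] : exists c : 'I_n -> localization P,
    f ^+ (n * m).+1 = \sum_t c t * phi ('X_t ^+ m).
  by apply: powers; apply: sqM; rewrite mem_nth // ltnW.
have [cg gE] : exists c : 'I_n -> localization P,
    g ^+ (n * m).+1 = \sum_t c t * phi ('X_t ^+ m).
  by apply: powers; apply: sqM; rewrite mem_nth.
(* Numerators over x_t^m: the section is x^alpha where t is r or s, and 0 for the other t. *)
pose sec t := if t \in [:: r; s] then phi ('X_t ^+ m * 'X_[alpha]) else 0.
have sec0 i j : i \notin [:: r; s] -> j \in [:: r; s] ->
    phi ('X_i ^+ m) * phi ('X_j ^+ m * 'X_[alpha]) = 0.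
  move=> irs jrs; rewrite -rmorphM /=.
  by rewrite ((pi0 _).2 (separating_monomial irs jrs)) rmorph0.
have [i j|z zE] := regular_pair_extend f_reg g_reg
  (y := fun t => phi ('X_t ^+ m)) (a := sec) _ fE gE.
  rewrite /sec; case: ifPn => jrs; case: ifPn => irs; rewrite ?mulr0 //.
  - by rewrite -!rmorphM; congr (phi _); ring.
  - exact: sec0.
  - by rewrite sec0.
have [h [u [u0 zu]]] := phi_frac z.
have p_rs : p \notin [:: r; s].
  by move: pqrs_uniq; rewrite /= !inE !negb_or => /andP[/and3P[_ -> ->]].
have [v1 v10 hp] : exists2 v, v@_0 != 0 & in_symbolic G m (v * ('X_p ^+ m * h)).
  apply: phi0; rewrite rmorphM -zu mulrA -zE /sec (negPf p_rs) mul0r //.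
have [v2 v20 hr] : exists2 v, v@_0 != 0 &
    in_symbolic G m (v * ('X_r ^+ m * (h - 'X_[alpha] * u))).
  apply: phi0; rewrite rmorphM rmorphB mulrBr -zu mulrA -zE /sec mem_head.
  by rewrite !rmorphM mulrA subrr.
(* v is a unit at the origin, and multiplying by x_t with t in e leaves the weight off e
   unchanged. *)
have cancelX (e : {set 'I_n}) t (g' v : S) : v@_0 != 0 -> e \in G -> t \in e ->
    in_symbolic G m (v * ('X_t ^+ m * g')) ->
    monomial_ideal (fun a => weight e a < m)%N g'.
  move=> v0 eG te /(_ e eG)/(local_monomial_ideal (@weight_lower n e m) v0) Ig a ea.
  have := Ig (U_(t) *+ m + a)%MM.
  rewrite mulrC mpolyXn mcoeffMX weightD weight_Mn te muln0; exact.
(* The extension z = h / u is compared with 0 at p through the edge pq, then with x^alpha at r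
   through rs; the latter makes the coefficient of h at alpha equal to the nonzero constant term of
   u. *)
have ha : h@_alpha = 0.
  apply: (cancelX _ _ _ _ v10 pqG _ hp); rewrite ?inE ?eqxx //.
  rewrite !weightD weight_Mn !weightU !inE eqxx muln0 add0n.
  by apply: leq_trans m3; do 2!case: (_ || _).
have : (h - 'X_[alpha] * u)@_alpha = 0.
  apply: (cancelX _ _ _ _ v20 rsG _ hr); rewrite ?inE ?eqxx //.
  rewrite !weightD weight_Mn !weightU !inE !eqxx orbT !addn0.
  move: p_rs; rewrite !inE => /negPf-> /=.
  by rewrite muln1 ltn_predL (leq_trans _ m3).
have uX : (u * 'X_[alpha])@_alpha = u@_0 by rewrite -[X in _@_X]addm0 mcoeffMX.
rewrite mcoeffB ha sub0r mulrC uX => /eqP.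
by rewrite oppr_eq0 (negPf u0).
Qed.

End Necessity.

(** * Four-cycles *)

Section FourCycles.
Set Implicit Arguments.
Unset Strict Implicit.

Variables (n : nat) (G : {set {set 'I_n}}).
Implicit Types (a b c d : 'I_n) (x : 'X_{1..n}).

Lemma weight_pair a b x : a != b -> weight [set a; b] x + x a + x b = mdeg x.
Proof.
move=> ab; rewrite mdegE (bigD1 a) //= (bigD1 b) //=; last by rewrite eq_sym.
rewrite -addnA addnC addnA; congr (_ + _); apply: eq_bigl => t.
by rewrite !inE negb_or.
Qed.

Lemma cycle4_light_edge m a b c d x :
    is_cycle4 G a b c d -> weight [set a; b] x < m -> weight [set c; d] x < m ->
  exists e, [/\ e \in G, weight e x < m, ~~ [disjoint [set a; b] & e]
              & ~~ [disjoint e & [set c; d]]].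
Proof.
move=> [abcd /subsetP cG] abm cdm.
have [ab ad bc cd] : [/\ a != b, d != a, b != c & c != d].
  move: abcd; rewrite /= !inE !negb_or => /and4P[/and3P[-> _ ad] /andP[-> _] -> _].
  by rewrite eq_sym.
have meet (e e' : {set 'I_n}) t : t \in e -> t \in e' -> ~~ [disjoint e & e'].
  by move=> te te'; apply/negP => dis; rewrite (disjointFr dis te) in te'.
have [bcm|bcm] := ltnP (weight [set b; c] x) m.
  exists [set b; c]; split=> //; first by apply: cG; rewrite !inE eqxx ?orbT.
    by apply: (meet _ _ b); rewrite !inE eqxx ?orbT.
  by apply: (meet _ _ c); rewrite !inE eqxx ?orbT.
exists [set d; a]; split=> //; first by apply: cG; rewrite !inE eqxx ?orbT.
- have := weight_pair x ab; have := weight_pair x ad.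
  by have := weight_pair x bc; have := weight_pair x cd; lia.
- by apply: (meet _ _ a); rewrite !inE eqxx ?orbT.
- by apply: (meet _ _ d); rewrite !inE eqxx ?orbT.
Qed.

Lemma is_cycle4_rot a b c d : is_cycle4 G a b c d -> is_cycle4 G b c d a.
Proof.
move=> [u /subsetP cG]; split; first by rewrite -(rot_uniq 1) in u.
apply/subsetP => e; rewrite !inE -!orbA => ecyc; apply: cG; rewrite !inE -!orbA.
by case/or4P: ecyc => ->; rewrite ?orbT.
Qed.

Lemma cycle4_connect m :
    (forall E, E \in G -> #|E| = 2) ->
    (forall E F : {set 'I_n}, E \in G -> F \in G -> [disjoint E & F] ->
       exists a b c d : 'I_n,
         [/\ is_cycle4 G a b c d,
             E \in cycle4_edges a b c d & F \in cycle4_edges a b c d]) ->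
  forall x e e', e \in G -> e' \in G -> weight e x < m -> weight e' x < m ->
  exists e'', [/\ e'' \in G, weight e'' x < m, ~~ [disjoint e & e'']
                & ~~ [disjoint e'' & e']].
Proof.
move=> G2 cyc x e e' eG e'G ex e'x.
have [dis|meet] := boolP [disjoint e & e']; last first.
  exists e; split=> //; rewrite -setI_eq0 setIid -card_gt0; by rewrite G2.
have [a [b [c [d [abcd ecyc e'cyc]]]]] := cyc e e' eG e'G dis.
have bcda := is_cycle4_rot abcd; have cdab := is_cycle4_rot bcda.
have dabc := is_cycle4_rot cdab.
have nmeet t : t \in e -> t \in e' -> False.
  by move=> te; rewrite (disjointFr dis te).
move: ecyc e'cyc; rewrite !inE -!orbA.
(* Of the sixteen positions on the cycle, the four opposite ones are covered by the four rotations;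
   in the others e and e' share a vertex. *)
case/or4P=> /eqP eE; case/or4P=> /eqP e'E; rewrite eE e'E in ex e'x nmeet *;
  try exact: (cycle4_light_edge _ ex e'x);
  by exfalso; do [apply: (nmeet a); by rewrite !inE eqxx ?orbT
    | apply: (nmeet b); by rewrite !inE eqxx ?orbT
    | apply: (nmeet c); by rewrite !inE eqxx ?orbT
    | apply: (nmeet d); by rewrite !inE eqxx ?orbT].
Qed.

End FourCycles.

Theorem theorem2p4 (k : fieldType) (n : nat) (hn : 3 <= n)
    (G : {set {set 'I_n}}) (hG : simple_graph G) (m : nat) (hm : 3 <= m) :
  cohen_macaulay_ideal (symbolic_power k G m) <->
  (forall E F : {set 'I_n}, E \in G -> F \in G -> [disjoint E & F] ->
     exists a b c d : 'I_n,
       [/\ is_cycle4 G a b c d,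
           E \in cycle4_edges a b c d & F \in cycle4_edges a b c d]).
Proof.
have [G2 Gcover] := hG; split=> [CM E F EG FG dis|cyc].
  apply: contrapT => no.
  have /eqP/cards2P[a [b [ab eE]]] := G2 E EG.
  have /eqP/cards2P[c [d [cd eF]]] := G2 F FG.
  rewrite {}eE {}eF in EG FG dis no.
  have ncm p q r s (pqG : [set p; q] \in G) (rsG : [set r; s] \in G) :
      uniq [:: p; q; r; s] -> [set p; r] \notin G -> [set p; s] \in G.
    move=> u pr; apply: contraT => ps.
    by have := not_cohen_macaulay G2 u pqG rsG pr ps hm CM.
  have neq (u v : 'I_n) : u \in [set a; b] -> v \in [set c; d] -> u != v.
    by move=> uE; apply: contraTneq => <-; rewrite (disjointFr dis uE).
  have [ac ad bc bd] : [/\ a != c, a != d, b != c & b != d].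
    by split; apply: neq; rewrite !inE eqxx ?orbT.
  have n1 : ~~ (([set a; c] \in G) && ([set b; d] \in G)).
    apply/negP => /andP[acG bdG]; apply: no; exists a, b, d, c; split.
    - split; first by rewrite /= !inE !negb_or ab ad ac bd bc eq_sym cd.
      apply/subsetP => e; rewrite !inE -!orbA => /or4P[]/eqP-> //.
        by rewrite setUC.
      by rewrite setUC.
    - by rewrite !inE eqxx.
    - by rewrite !inE [[set c; d]]setUC eqxx ?orbT.
  have n2 : ~~ (([set a; d] \in G) && ([set b; c] \in G)).
    apply/negP => /andP[adG bcG]; apply: no; exists a, b, c, d; split.
    - split; first by rewrite /= !inE !negb_or ab ad ac bd bc cd.
      apply/subsetP => e; rewrite !inE -!orbA => /or4P[]/eqP-> //.
      by rewrite setUC.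
    - by rewrite !inE eqxx.
    - by rewrite !inE eqxx ?orbT.
  have baG : [set b; a] \in G by rewrite setUC.
  have dcG : [set d; c] \in G by rewrite setUC.
  (* One non-edge from each pair: the two always share a vertex, which plays the role of p; the
     opposite edge is rs. *)
  move: n1 n2; rewrite !negb_and => /orP[n1|n1] /orP[n2|n2].
  - by case/negP: n2; apply: (ncm a b c d) => //; rewrite /= !inE !negb_or ab ac ad bc bd cd.
  - case/negP: n2; rewrite setUC; apply: (ncm c d a b) => //; last by rewrite setUC.
    by rewrite /= !inE !negb_or cd !(eq_sym c) !(eq_sym d) ac ad bc bd ab.
  - case/negP: n1; rewrite setUC; apply: (ncm d c a b) => //; last by rewrite setUC.
    by rewrite /= !inE !negb_or !(eq_sym d) !(eq_sym c a) (eq_sym c b) cd ac ad bc bd ab.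
  - case/negP: n1; apply: (ncm b a c d) => //.
    by rewrite /= !inE !negb_or [b == a]eq_sym ab ac ad bc bd cd.
apply: symbolic_power_cohen_macaulay => //.
(* The first vertex lies on an edge, so G is not empty. *)
- apply/eqP => G0; have := in_setT (Ordinal (ltnW (ltnW hn))).
  by rewrite -Gcover G0 /cover big_set0 inE.
- exact: leq_trans hm.
- exact: cycle4_connect.
Qed.
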